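(* The Courant algebroid induced by a Poisson structure $\pi$ on $M$ acts on $T^*M$ by affine connections on $M$ that are flat when restricted to Hamiltonian vector fields. That is: let $\pi\in\mathfrak{X}^2(M)$ be a Poisson structure and let $\nabla$ be an affine connection on $M$ whose curvature satisfies $R_\nabla(\pi(\alpha),\pi(\beta))=0$ for all $\alpha,\beta\in\Omega^1(M)$. Then the pair $(\mathrm{pr},\varrho)$, where $\mathrm{pr}:T^*M\to M$ is the projection and $\varrho(X+\alpha)=\pi(\alpha)^{h}$, is a Courant algebroid action on the manifold $T^*M$ of the Courant algebroid on $TM\oplus T^*M$ induced by $\pi$.
   Context: Everything is smooth. For a Poisson bivector $\pi$, view $\pi:T^*M\to TM$ by $\beta(\pi(\alpha))=\pi(\alpha,\beta)$, and let $[\alpha,\beta]_\pi:=L_{\pi(\alpha)}\beta-L_{\pi(\beta)}\alpha-d\pi(\alpha,\beta)$, which makes $T^*M$ a Lie algebroid with anchor $\pi$. The condition $R_\nabla(\pi(\alpha),\pi(\beta))=0$ for all $\alpha,\beta$ is equivalent to $R_\nabla$ vanishing on pairs of Hamiltonian vector fields $\pi(df)$. The Courant algebroid induced by $\pi$ (the double of the Lie bialgebroid $(TM,T^*M)$, where $TM$ has zero anchor and zero bracket) is $TM\oplus T^*M$ with pairing $\langle X+\alpha,Y+\beta\rangle_+=\alpha(Y)+\beta(X)$, anchor $\rho=\pi\circ\mathrm{pr}_{T^*M}$, and bracket $$[X+\alpha,Y+\beta]=L^\pi_\alpha Y-\iota_\beta d_\pi X+[\alpha,\beta]_\pi,$$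 where $\beta(L^\pi_\alpha Y)=\pi(\alpha)(\beta(Y))-([\alpha,\beta]_\pi)(Y)$, and $(d_\pi X)(\alpha,\beta)=\pi(\alpha)(\beta(X))-\pi(\beta)(\alpha(X))-([\alpha,\beta]_\pi)(X)$ is the Lie algebroid differential. For $Z\in\mathfrak{X}(M)$, $Z^h\in\mathfrak{X}(T^*M)$ is the horizontal lift with respect to the dual connection of $\nabla$ on $T^*M$. A Courant algebroid action of a Courant algebroid $(\mathbb{E},\langle\,,\rangle,\rho,[\,,])$ over $M$ on a manifold $M'$ is a pair $(\Phi,\varrho)$ of a smooth map $\Phi:M'\to M$ and an $\mathbb{R}$-linear map $\varrho:\Gamma(\mathbb{E})\to\mathfrak{X}(M')$ such that for all $a,b\in\Gamma(\mathbb{E})$, $f\in C^\infty(M)$, $q\in M'$: $\Phi_{*q}(\varrho(a)_q)=\rho(a)_{\Phi(q)}$, $\varrho(fa)=(\Phi^*f)\varrho(a)$, and $[\varrho(a),\varrho(b)]_{\mathrm{Lie}}=\varrho([a,b])$. *)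

(* Defs.v *)
From HB Require Import structures.
From mathcomp Require Import all_boot all_order all_algebra.
From mathcomp Require Import all_classical all_reals all_analysis.
From mathcomp Require Import ring.

Set Implicit Arguments.
Unset Strict Implicit.
Unset Printing Implicit Defensive.

Import Order.TTheory GRing.Theory Num.Theory.
Import numFieldNormedType.Exports.
Local Open Scope classical_set_scope.
Local Open Scope ring_scope.

(* A manifold is a set with an atlas; its topology is the one induced by the
   atlas.  Vector fields are the derivations of the algebra of smooth functions,
   1-forms are the C^oo(M)-linear maps from vector fields to smooth functions,
   and tangent vectors at p are the derivations at p of smooth functions. *)

Section Smoothness.
Variables (R : realType) (V : normedModType R).

Fixpoint Ck_at (k : nat) (f : V -> R) (x : V) : Prop :=
  match k with
  | 0%N => \forall y \near x, {for y, continuous f}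
  | k'.+1 => (\forall y \near x, differentiable f y) /\
             forall v : V, Ck_at k' ('D_v f) x
  end.

(* f is C^oo at x iff it is C^k near x for every k; on an open set, being so at
   every point is the usual smoothness. *)
Definition smooth_at (f : V -> R) (x : V) : Prop := forall k, Ck_at k f x.

Definition smooth_vec_at m (g : V -> 'rV[R]_m) (x : V) : Prop :=
  forall j : 'I_m, smooth_at (fun y => g y 0 j) x.

Lemma near_eq_differentiable (f g : V -> R) (x : V) :
  (\forall y \near x, f y = g y) -> differentiable f x -> differentiable g x.
Proof.
move=> fg df.
have gh : g = f \+ (g - f) by apply/funext => y; rewrite /= addrC subrK.
rewrite gh; apply: differentiableD => //.
set h := g - f; have h0 : \forall y \near x, h y = 0.
  by near=> y; rewrite /h fctE; apply/eqP; rewrite subr_eq0 eq_sym; apply/eqP; near: y.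
have h0' : \forall z \near (0 : V), h (z + x) = 0.
  by move: h0; rewrite (near_shift 0 x) subr0. 
have e : h \o shift x = cst (h x) + (\0 : {linear V -> R}) +o_ (0 : V) id.
  apply/eqaddoP => e e0; near=> y.
  rewrite !fctE /= (nbhs_singleton h0) addr0 subr0.
  have -> : h (y + x) = 0 by near: y.
  by rewrite normr0 mulr_ge0// ltW.
have c0 : continuous (\0 : {linear V -> R}) by move=> z; exact: cvg_cst.
have d0 := diff_unique c0 e.
by apply/diff_locallyP; rewrite d0; split.
Unshelve. all: by end_near. Qed.

Lemma Ck_at_ext k (f g : V -> R) (x : V) :
  (\forall y \near x, f y = g y) -> Ck_at k f x -> Ck_at k g x.
Proof.
elim: k f g x => [|k IH] f g x /near_join fg.
  move=> fc; near=> y.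
  have Efg : \forall z \near y, f z = g z by near: y.
  have fy : {for y, continuous f} by near: y.
  rewrite /prop_for /continuous_at -(nbhs_singleton Efg).
  by apply: cvg_trans fy; apply: near_eq_cvg.
move=> [fd fD]; split.
  near=> y; apply: (@near_eq_differentiable f); near: y => //.
move=> v; apply: IH (fD v).
by near=> y; apply: near_eq_derive; near: y.
Unshelve. all: by end_near. Qed.

Lemma Ck_atS k (f : V -> R) (x : V) : Ck_at k.+1 f x -> Ck_at k f x.
Proof.
elim: k f x => [|k IH] f x [fd fD]; last by split => // v; exact/IH/fD.
by near=> y; apply: differentiable_continuous; near: y.
Unshelve. all: by end_near. Qed.

Lemma Ck_at_cst k (c : R) (x : V) : Ck_at k (cst c) x.
Proof.
elim: k c x => [|k IH] c x /=.
  by near=> y; exact: cvg_cst.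
split; first by near=> y; exact: differentiable_cst.
move=> v; apply: Ck_at_ext (IH 0 x).
by near=> y; rewrite derive_cst.
Unshelve. all: by end_near. Qed.

Lemma Ck_atD k (f g : V -> R) (x : V) :
  Ck_at k f x -> Ck_at k g x -> Ck_at k (f + g) x.
Proof.
elim: k f g x => [|k IH] f g x.
  by move=> fc gc /=; near=> y; apply: continuousD; near: y.
move=> [fd fD] [gd gD]; split.
  by near=> y; apply: differentiableD; near: y.
move=> v; apply: Ck_at_ext (IH _ _ _ (fD v) (gD v)).
by near=> y; rewrite deriveD//; apply: diff_derivable; near: y.
Unshelve. all: by end_near. Qed.

Lemma Ck_atM k (f g : V -> R) (x : V) :
  Ck_at k f x -> Ck_at k g x -> Ck_at k (f * g) x.
Proof.
elim: k f g x => [|k IH] f g x.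
  by move=> fc gc /=; near=> y; apply: continuousM; near: y.
move=> fS gS; have [fd fD] := fS; have [gd gD] := gS; split.
  by near=> y; apply: differentiableM; near: y.
move=> v; apply: Ck_at_ext
  (Ck_atD (IH _ _ _ (Ck_atS fS) (gD v)) (IH _ _ _ (Ck_atS gS) (fD v))).
by near=> y; rewrite deriveM//; apply: diff_derivable; near: y.
Unshelve. all: by end_near. Qed.

End Smoothness.

(* A chart maps [chart_dom] bijectively onto [chart_cod], with inverse
   [chart_inv]; the values of the two maps elsewhere are irrelevant. *)
Record chart (R : realType) (T : Type) (n : nat) := Chart {
  chart_dom : set T;
  chart_cod : set 'rV[R]_n;
  chart_map : T -> 'rV[R]_n;
  chart_inv : 'rV[R]_n -> T
}.

Record is_chart (R : realType) (T : Type) (n : nat) (c : chart R T n) : Prop := {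
  chart_cod_open : open (chart_cod c);
  chart_mapP : forall p, chart_dom c p -> chart_cod c (chart_map c p);
  chart_invP : forall x, chart_cod c x -> chart_dom c (chart_inv c x);
  chart_mapK : forall p, chart_dom c p -> chart_inv c (chart_map c p) = p;
  chart_invK : forall x, chart_cod c x -> chart_map c (chart_inv c x) = x
}.

(* The data of an atlas; the axioms are in [is_manifold]. *)
Record atlas (R : realType) := Atlas {
  point_of :> Type;
  dim : nat;
  chart_index : Type;
  chart_of : chart_index -> chart R point_of dim
}.

Section Manifold.
Variable R : realType.

Definition dom_of (M : atlas R) (i : chart_index M) := chart_dom (chart_of i).
Definition cod_of (M : atlas R) (i : chart_index M) := chart_cod (chart_of i).
Definition map_of (M : atlas R) (i : chart_index M) := chart_map (chart_of i).
Definition inv_of (M : atlas R) (i : chart_index M) := chart_inv (chart_of i).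

Definition atlas_open (M : atlas R) (W : set M) : Prop :=
  forall i : chart_index M, open (cod_of i `&` inv_of i @^-1` W).

Definition smooth_map (M N : atlas R) (Phi : M -> N) : Prop :=
  forall (i : chart_index M) (j : chart_index N) (x : 'rV[R]_(dim M)),
    cod_of i x -> dom_of j (Phi (inv_of i x)) ->
    (\forall y \near x, dom_of j (Phi (inv_of i y))) /\
    smooth_vec_at (map_of j \o Phi \o inv_of i) x.

(* The third condition says that the domains of the charts are open and that
   the changes of charts are smooth. *)
Record is_manifold (M : atlas R) : Prop := {
  manifold_chart : forall i : chart_index M, is_chart (chart_of i);
  manifold_cover : forall p : M, exists i : chart_index M, dom_of i p;
  manifold_smooth : smooth_map (@id M);
  manifold_hausdorff : forall p q : M, p <> q ->
    exists U V : set M, [/\ atlas_open U, atlas_open V, U p, V q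
                           & U `&` V = set0];
  manifold_second_countable : exists B : nat -> set M,
    (forall k, atlas_open (B k)) /\
    (forall (W : set M) (p : M), atlas_open W -> W p ->
       exists k, B k p /\ B k `<=` W)
}.

End Manifold.

Section SmoothFunctions.
Variables (R : realType) (M : atlas R).

Definition smooth_fun (f : M -> R) : Prop :=
  forall (i : chart_index M) x, cod_of i x -> smooth_at (f \o inv_of i) x.

Definition smooth_funb : {pred M -> R} := fun f => `[< smooth_fun f >].

Fact smooth_funb_subring : subring_closed smooth_funb.
Proof.
split; first by apply/asboolP => i x _ k; exact: Ck_at_cst.
  move=> f g /asboolP fs /asboolP gs; apply/asboolP => i x xi k.
  have -> : (f - g) \o inv_of i = f \o inv_of i + cst (-1) * (g \o inv_of i).
    by apply/funext => y; rewrite !fctE mulN1r.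
  by apply: Ck_atD (fs i x xi k) _; apply: Ck_atM (gs i x xi k); exact: Ck_at_cst.
move=> f g /asboolP fs /asboolP gs; apply/asboolP => i x xi k.
exact: Ck_atM (fs i x xi k) (gs i x xi k).
Qed.

HB.instance Definition _ :=
  GRing.isSubringClosed.Build (M -> R) smooth_funb smooth_funb_subring.

Record cinf := Cinf { cinf_val :> M -> R; _ : cinf_val \in smooth_funb }.

HB.instance Definition _ := [isSub for cinf_val].
HB.instance Definition _ := [Choice of cinf by <:].
HB.instance Definition _ :=
  GRing.SubChoice_isSubComPzRing.Build (M -> R) smooth_funb cinf
    (subringClosedP smooth_funb).

Fact cinf_cst_subproof (c : R) : (cst c : M -> R) \in smooth_funb.
Proof. by apply/asboolP => i x _ k; exact: Ck_at_cst. Qed.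
Definition cinf_cst (c : R) : cinf := Cinf (cinf_cst_subproof c).

(* [f] as an element of C^oo(M) when [f] is smooth, and 0 otherwise. *)
Definition to_cinf (f : M -> R) : cinf := insubd 0 f.

End SmoothFunctions.

Section VectorFields.
Variables (R : realType) (M : atlas R).
Local Notation A := (cinf M).

Definition derivation (D : A -> A^o) : Prop :=
  [/\ forall (c : R) (f g : A), D (cinf_cst M c * f + g) = cinf_cst M c * D f + D g
    & forall f g : A, D (f * g) = f * D g + g * D f].
Definition derivationb : {pred A -> A^o} := fun D => `[< derivation D >].

Fact derivationb_submod : submod_closed derivationb.
Proof.
split.
  by apply/asboolP; split=> [c f g|f g] /=; rewrite !mulr0 addr0.
move=> h D E /asboolP[D1 D2] /asboolP[E1 E2]; apply/asboolP; split=> [c f g|f g].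
  by rewrite !fctE D1 E1 /GRing.scale /=; ring.
by rewrite !fctE D2 E2 /GRing.scale /=; ring.
Qed.

HB.instance Definition _ :=
  GRing.isSubmodClosed.Build A (A -> A^o) derivationb derivationb_submod.

Record vfield := VField { vfield_val :> A -> A^o; _ : vfield_val \in derivationb }.

HB.instance Definition _ := [isSub for vfield_val].
HB.instance Definition _ := [Choice of vfield by <:].
HB.instance Definition _ := [SubChoice_isSubLmodule of vfield by <:].

Lemma vfieldP (X : vfield) : derivation X.
Proof. by case: X => X /= /asboolP. Qed.

Lemma vfieldD (X : vfield) (f g : A) : X (f + g) = X f + X g.
Proof.
have [X1 _] := vfieldP X; have := X1 1 f g.
by rewrite (_ : cinf_cst M 1 = 1) ?mul1r//; exact/val_inj.
Qed.

Lemma vfield_linE (f : A) (X Y : vfield) (g : A) :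
  (f *: X + Y) g = f * X g + Y g.
Proof. by []. Qed.

Fact lie_subproof (X Y : vfield) :
  (fun f : A => X (Y f) - Y (X f) : A^o) \in derivationb.
Proof.
have [X1 X2] := vfieldP X; have [Y1 Y2] := vfieldP Y.
apply/asboolP; split=> [c f g|f g].
  by rewrite X1 Y1 X1 Y1; ring.
by rewrite X2 Y2 !vfieldD !X2 !Y2; ring.
Qed.
Definition lie (X Y : vfield) : vfield := VField (lie_subproof X Y).

Lemma lieE (X Y : vfield) (f : A) : lie X Y f = X (Y f) - Y (X f).
Proof. by []. Qed.

Definition form_pred (alpha : vfield -> A^o) : Prop :=
  forall (f : A) (X Y : vfield), alpha (f *: X + Y) = f * alpha X + alpha Y.
Definition form_predb : {pred vfield -> A^o} := fun alpha => `[< form_pred alpha >].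

Fact form_predb_submod : submod_closed form_predb.
Proof.
split; first by apply/asboolP => f X Y /=; rewrite mulr0 addr0.
move=> h D E /asboolP D1 /asboolP E1; apply/asboolP => f X Y.
by rewrite !fctE D1 E1 /GRing.scale /=; ring.
Qed.

HB.instance Definition _ :=
  GRing.isSubmodClosed.Build A (vfield -> A^o) form_predb form_predb_submod.

Record one_form := Form { form_val :> vfield -> A^o; _ : form_val \in form_predb }.

HB.instance Definition _ := [isSub for form_val].
HB.instance Definition _ := [Choice of one_form by <:].
HB.instance Definition _ := [SubChoice_isSubLmodule of one_form by <:].

Lemma formP (alpha : one_form) : form_pred alpha.
Proof. by case: alpha => alpha /= /asboolP. Qed.

Fact dform_subproof (f : A) : (fun X : vfield => X f) \in form_predb.
Proof. by apply/asboolP => g X Y. Qed.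
Definition dform (f : A) : one_form := Form (dform_subproof f).

Lemma lieZD (X : vfield) (f : A) (Y Z : vfield) :
  lie X (f *: Y + Z) = f *: lie X Y + (X f *: Y + lie X Z).
Proof.
have [X1 X2] := vfieldP X; apply/val_inj/funext => g.
change (lie X (f *: Y + Z) g = f * lie X Y g + (X f * Y g + lie X Z g)).
by rewrite !lieE !vfield_linE vfieldD X2; ring.
Qed.

Fact lie_form_subproof (X : vfield) (beta : one_form) :
  (fun Y : vfield => X (beta Y) - beta (lie X Y) : A^o) \in form_predb.
Proof.
have [X1 X2] := vfieldP X.
apply/asboolP => f Y Z.
by rewrite lieZD !formP vfieldD X2; ring.
Qed.
Definition lie_form (X : vfield) (beta : one_form) : one_form :=
  Form (lie_form_subproof X beta).

(* The vector field Z with beta(Z) = T(beta) for all 1-forms beta, which exists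
   and is unique when T is C^oo(M)-linear. *)
Definition vfield_of (T : one_form -> A) : vfield :=
  xget 0 [set Z : vfield | forall beta : one_form, beta Z = T beta].

Record connection := Connection {
  nabla :> vfield -> vfield -> vfield;
  nabla_linl : forall (f : A) (X Y Z : vfield),
    nabla (f *: X + Y) Z = f *: nabla X Z + nabla Y Z;
  nabla_addr : forall X Y Z : vfield, nabla X (Y + Z) = nabla X Y + nabla X Z;
  nabla_leibniz : forall (f : A) (X Y : vfield),
    nabla X (f *: Y) = X f *: Y + f *: nabla X Y
}.

Definition curvature (D : connection) (X Y Z : vfield) : vfield :=
  D X (D Y Z) - D Y (D X Z) - D (lie X Y) Z.

Fact dual_nabla_subproof (D : connection) (Z : vfield) (alpha : one_form) :
  (fun Y : vfield => Z (alpha Y) - alpha (D Z Y) : A^o) \in form_predb.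
Proof.
have [X1 X2] := vfieldP Z.
apply/asboolP => f X Y.
rewrite nabla_addr nabla_leibniz -addrA !formP vfieldD X2.
by ring.
Qed.
Definition dual_nabla (D : connection) (Z : vfield) (alpha : one_form) : one_form :=
  Form (dual_nabla_subproof D Z alpha).

(* A bivector field, as the skew-symmetric bundle map T*M -> TM that it
   induces; pi(alpha, beta) is beta(pi(alpha)). *)
Record bivector := Bivector {
  sharp :> one_form -> vfield;
  sharp_lin : forall (f : A) (alpha beta : one_form),
    sharp (f *: alpha + beta) = f *: sharp alpha + sharp beta;
  sharp_alt : forall alpha : one_form, alpha (sharp alpha) = 0
}.

Definition bivector_eval (pi : bivector) (alpha beta : one_form) : A :=
  beta (pi alpha).

Definition poisson_bracket (pi : bivector) (f g : A) : A :=
  bivector_eval pi (dform f) (dform g).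

Definition is_poisson (pi : bivector) : Prop := forall f g h : A,
  poisson_bracket pi f (poisson_bracket pi g h) +
  poisson_bracket pi g (poisson_bracket pi h f) +
  poisson_bracket pi h (poisson_bracket pi f g) = 0.

Definition koszul (pi : bivector) (alpha beta : one_form) : one_form :=
  lie_form (pi alpha) beta - lie_form (pi beta) alpha
  - dform (bivector_eval pi alpha beta).

Definition pi_lie (pi : bivector) (alpha : one_form) (Y : vfield) : vfield :=
  vfield_of (fun beta => pi alpha (beta Y) - koszul pi alpha beta Y).

Definition pi_diff (pi : bivector) (X : vfield) (alpha beta : one_form) : A :=
  pi alpha (beta X) - pi beta (alpha X) - koszul pi alpha beta X.

Definition pi_diff_contract (pi : bivector) (X : vfield) (beta : one_form) : vfield :=
  vfield_of (fun gamma => pi_diff pi X beta gamma).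

(* The vector bundle enters only through its C^oo(M)-module of sections. *)
Record courant_data := CourantData {
  sect : lmodType A;
  pairing : sect -> sect -> A;
  anchor : sect -> vfield;
  dorfman : sect -> sect -> sect
}.

Record is_courant (E : courant_data) : Prop := {
  pairing_sym : forall a b : sect E, pairing a b = pairing b a;
  pairing_lin : forall (f : A) (a b c : sect E),
    pairing (f *: a + b) c = f * pairing a c + pairing b c;
  pairing_nondegenerate : forall phi : sect E -> A,
    (forall (f : A) a b, phi (f *: a + b) = f * phi a + phi b) ->
    exists! a : sect E, forall b, pairing a b = phi b;
  anchor_lin : forall (f : A) (a b : sect E),
    anchor (f *: a + b) = f *: anchor a + anchor b;
  dorfman_linl : forall (c : R) (a b d : sect E),
    dorfman (cinf_cst M c *: a + b) d
    = cinf_cst M c *: dorfman a d + dorfman b d;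
  dorfman_linr : forall (c : R) (a b d : sect E),
    dorfman d (cinf_cst M c *: a + b)
    = cinf_cst M c *: dorfman d a + dorfman d b;
  dorfman_jacobi : forall a b c : sect E,
    dorfman a (dorfman b c) = dorfman (dorfman a b) c + dorfman b (dorfman a c);
  dorfman_invariant : forall a b c : sect E,
    anchor a (pairing b c) = pairing (dorfman a b) c + pairing b (dorfman a c);
  dorfman_sym : forall a b c : sect E,
    pairing (dorfman a b + dorfman b a) c = anchor c (pairing a b)
}.

(* The Courant algebroid on TM + T*M induced by pi. *)
Definition poisson_courant (pi : bivector) : courant_data :=
  @CourantData (vfield * one_form)%type
    (fun a b => a.2 b.1 + b.2 a.1)
    (fun a => pi a.2)
    (fun a b => (pi_lie pi a.2 b.1 - pi_diff_contract pi a.1 b.2,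
                 koszul pi a.2 b.2)).

End VectorFields.

Definition pullback (R : realType) (M N : atlas R) (Phi : N -> M) (f : cinf M) :
  cinf N := to_cinf (f \o Phi).

Record courant_action (R : realType) (M N : atlas R) (E : courant_data M)
    (Phi : N -> M) (rho : sect E -> vfield N) : Prop := {
  action_courant : is_courant E;
  action_manifold : is_manifold N;
  action_smooth : smooth_map Phi;
  action_linear : forall (c : R) (a b : sect E),
    rho (cinf_cst M c *: a + b) = cinf_cst N c *: rho a + rho b;
  (* Phi_* (rho(a)_q) = anchor(a)_(Phi q), evaluated on functions *)
  action_anchor : forall (a : sect E) (q : N) (f : cinf M),
    rho a (pullback Phi f) q = anchor a f (Phi q);
  action_module : forall (f : cinf M) (a : sect E),
    rho (f *: a) = pullback Phi f *: rho a;
  action_bracket : forall a b : sect E, lie (rho a) (rho b) = rho (dorfman a b)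
}.

Section Cotangent.
Variables (R : realType) (M : atlas R).
Local Notation A := (cinf M).

Definition tangent_pred (p : M) (v : A -> R^o) : Prop :=
  (forall (c : R) (f g : A), v (cinf_cst M c * f + g) = c * v f + v g) /\
  (forall f g : A, v (f * g) = f p * v g + g p * v f).
Definition tangent_predb (p : M) : {pred A -> R^o} :=
  fun v => `[< tangent_pred p v >].

Fact tangent_predb_submod (p : M) : submod_closed (tangent_predb p).
Proof.
split.
  by apply/asboolP; split=> [c f g|f g] /=; rewrite !mulr0 addr0.
move=> h D E /asboolP[D1 D2] /asboolP[E1 E2]; apply/asboolP; split=> [c f g|f g].
  by rewrite !fctE D1 E1 /GRing.scale /=; ring.
by rewrite !fctE D2 E2 /GRing.scale /=; ring.
Qed.

HB.instance Definition _ (p : M) :=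
  GRing.isSubmodClosed.Build R (A -> R^o) (tangent_predb p)
    (tangent_predb_submod p).

Record tangent (p : M) :=
  Tangent { tangent_val :> A -> R^o; _ : tangent_val \in tangent_predb p }.

HB.instance Definition _ (p : M) := [isSub for @tangent_val p].
HB.instance Definition _ (p : M) := [Choice of tangent p by <:].
HB.instance Definition _ (p : M) := [SubChoice_isSubLmodule of tangent p by <:].

Fact vfield_at_subproof (X : vfield M) (p : M) :
  (fun f : A => X f p : R^o) \in tangent_predb p.
Proof.
have [X1 X2] := vfieldP X.
by apply/asboolP; split=> [c f g|f g]; rewrite ?X1 ?X2.
Qed.
Definition vfield_at (X : vfield M) (p : M) : tangent p :=
  Tangent (vfield_at_subproof X p).

(* The coordinate vector d/dx^j at p, for p in the domain of the chart i; it is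
   a derivation at p by the Leibniz rule. *)
Definition coord_vector (i : chart_index M) (p : M) (j : 'I_(dim M)) : tangent p :=
  insubd 0 (fun f : A => 'D_(delta_mx 0 j) (f \o inv_of i) (map_of i p) : R^o).

Definition cotangent_pred (p : M) (xi : tangent p -> R^o) : Prop :=
  forall (c : R) (v w : tangent p), xi (c *: v + w) = c * xi v + xi w.
Definition cotangent_predb (p : M) : {pred tangent p -> R^o} :=
  fun xi => `[< cotangent_pred xi >].

Fact cotangent_predb_submod (p : M) : submod_closed (@cotangent_predb p).
Proof.
split; first by apply/asboolP => c v w /=; rewrite mulr0 addr0.
move=> h D E /asboolP D1 /asboolP E1; apply/asboolP => c v w.
by rewrite !fctE D1 E1 /GRing.scale /=; ring.
Qed.

HB.instance Definition _ (p : M) :=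
  GRing.isSubmodClosed.Build R (tangent p -> R^o) (@cotangent_predb p)
    (@cotangent_predb_submod p).

Record cotangent (p : M) := Cotangent
  { cotangent_val :> tangent p -> R^o; _ : cotangent_val \in @cotangent_predb p }.

HB.instance Definition _ (p : M) := [isSub for @cotangent_val p].
HB.instance Definition _ (p : M) := [Choice of cotangent p by <:].
HB.instance Definition _ (p : M) :=
  [SubChoice_isSubLmodule of cotangent p by <:].

(* The chart of T*M induced by the chart i of M: xi = sum_j y_j dx^j at p has
   coordinates (x(p), y), where y_j is the value of xi on d/dx^j. *)
Definition cotangent_chart (i : chart_index M) :
    chart R {p : M & cotangent p} (dim M + dim M) :=
  @Chart R {p : M & cotangent p} (dim M + dim M)
    [set z | dom_of i (projT1 z)]
    [set x | cod_of i (lsubmx x)]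
    (fun z => row_mx (map_of i (projT1 z))
                     (\row_j projT2 z (coord_vector i (projT1 z) j)))
    (fun x => existT cotangent (inv_of i (lsubmx x))
       (xget 0 [set xi : cotangent (inv_of i (lsubmx x)) |
                 forall j, xi (coord_vector i (inv_of i (lsubmx x)) j)
                           = rsubmx x 0 j])).

Definition cotangent_bundle : atlas R := Atlas cotangent_chart.

Definition cotangent_proj (z : cotangent_bundle) : M := projT1 z.

(* The value at p of a 1-form: the covector xi with xi(X_p) = alpha(X)(p). *)
Definition form_at (alpha : one_form M) (p : M) : cotangent p :=
  xget 0 [set xi : cotangent p |
           forall X : vfield M, xi (vfield_at X p) = alpha X p].

Definition form_section (alpha : one_form M) (p : M) : cotangent_bundle :=
  existT cotangent p (form_at alpha p).

(* The horizontal subspace of the dual connection at z in T*M: the vectors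
   alpha_*(Z_p), where p is the base point of z and alpha is a 1-form with
   alpha_p = z and (nabla*_Z alpha)_p = 0. *)
Definition horizontal (D : connection M) (z : cotangent_bundle)
    (w : cinf cotangent_bundle -> R) : Prop :=
  exists (Z : vfield M) (alpha : one_form M),
    [/\ form_section alpha (cotangent_proj z) = z,
        forall Y : vfield M, dual_nabla D Z alpha Y (cotangent_proj z) = 0
      & forall F : cinf cotangent_bundle,
          w F = Z (pullback (form_section alpha) F) (cotangent_proj z)].

(* Z^h, the vector field on T*M that is horizontal and projects to Z. *)
Definition hlift (D : connection M) (Z : vfield M) : vfield cotangent_bundle :=
  xget 0 [set W : vfield cotangent_bundle | forall z : cotangent_bundle,
    horizontal D z (fun F => W F z) /\
    forall f : cinf M, W (pullback cotangent_proj f) z = Z f (cotangent_proj z)].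

End Cotangent.

(* Main.v *)
Require Import Defs.
From HB Require Import structures.
From mathcomp Require Import all_boot all_order all_algebra.
From mathcomp Require Import all_classical all_reals all_analysis.
From mathcomp Require Import ring lra.

Set Implicit Arguments.
Unset Strict Implicit.
Unset Printing Implicit Defensive.

Import Order.TTheory GRing.Theory Num.Theory.
Import numFieldNormedType.Exports.
Local Open Scope classical_set_scope.
Local Open Scope ring_scope.

(** Two facts make the theorem true: [TM + T*M] is a Courant algebroid, and
    horizontal lifting preserves brackets of the fields [pi alpha].

    For the first, the Koszul bracket and the anchor [pi] make the 1-forms a Lie
    algebroid. The defect of [pi [alpha, beta] = [pi alpha, pi beta]] is tensorial
    and vanishes on exact forms by the Jacobi identity of the Poisson bracket
    ([sharp_koszul]); the Jacobi identity of the Koszul bracket is then Cartan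
    calculus ([koszul_jacobi]). The vector field part of the Dorfman bracket is
    given by its pairing with 1-forms, so that the axioms become identities in the
    ring of functions ([poisson_courant_is_courant]).

    For the second, a vector field on [T*M] is determined by its values on the
    functions [pr^* f] and on the momenta [l_Y], [l_Y (xi) = xi (Y)]
    ([bundle_vfield_eq]). The lift of [Z] maps [pr^* f] to [pr^* (Z f)] and [l_Y]
    to [l_(D_Z Y)] ([hlift_pullback], [hlift_momentum]). All axioms of the action
    can be read off from these two formulas; for the bracket axiom, the commutator
    of two lifts sends [l_Y] to the momentum of [[D_Z, D_Z'] Y], which is
    [D_[Z, Z'] Y] when the curvature vanishes ([hlift_lie]), and the bracket of
    [pi alpha] and [pi beta] is [pi] of the Koszul bracket.

    The analytic part serves to compare the algebraic definition of vector fields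
    and tangent vectors as derivations with coordinates. Hadamard's lemma
    ([hadamard]) and bump functions ([bump_exists]) show that a derivation at a
    point is determined by its values on coordinate functions ([pder_coord]). On
    [M] this yields local generators of the module of vector fields
    ([local_generators]), the reflexivity that represents linear maps on 1-forms by
    vector fields ([vfield_ofE]), and the charts of the cotangent bundle
    ([cotangent_bundle_is_manifold]); on [T*M] it yields [bundle_vfield_eq] and the
    smoothness of the horizontal lift. The latter exists because through every
    covector there is a 1-form that is parallel along [Z] at the base point
    ([parallel_form_through]). *)

(** * Smooth functions on normed spaces *)

Section SmoothCalculus.
Variables (R : realType) (V : normedModType R).
Implicit Types f g : V -> R.

Lemma smooth_at_ext f g x :
  (\forall y \near x, f y = g y) -> smooth_at f x -> smooth_at g x.
Proof. by move=> fg sf k; exact: Ck_at_ext (sf k). Qed.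

Lemma smooth_at_cst (c : R) x : smooth_at (cst c : V -> R) x.
Proof. by move=> k; exact: Ck_at_cst. Qed.

Lemma smooth_atD f g x : smooth_at f x -> smooth_at g x -> smooth_at (f + g) x.
Proof. by move=> sf sg k; exact: Ck_atD. Qed.

Lemma smooth_atM f g x : smooth_at f x -> smooth_at g x -> smooth_at (f * g) x.
Proof. by move=> sf sg k; exact: Ck_atM. Qed.

Lemma smooth_atB f g x : smooth_at f x -> smooth_at g x -> smooth_at (f - g) x.
Proof.
move=> sf sg; have -> : f - g = f + cst (-1) * g.
  by apply/funext => y; rewrite !fctE mulN1r.
by apply: smooth_atD => //; apply: smooth_atM => //; exact: smooth_at_cst.
Qed.

Lemma Ck_at_sum k (I : Type) (r : seq I) (F : I -> V -> R) x :
  (forall i, Ck_at k (F i) x) -> Ck_at k (\sum_(i <- r) F i) x.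
Proof.
move=> sF; elim: r => [|i r IH]; first by rewrite big_nil; exact: Ck_at_cst.
by rewrite big_cons; apply: Ck_atD.
Qed.

Lemma smooth_at_sum (I : Type) (r : seq I) (F : I -> V -> R) x :
  (forall i, smooth_at (F i) x) -> smooth_at (\sum_(i <- r) F i) x.
Proof. by move=> sF k; apply: Ck_at_sum => i; exact: sF. Qed.

Lemma smooth_at_near_differentiable f x :
  smooth_at f x -> \forall y \near x, differentiable f y.
Proof. by move=> /(_ 1%N)[]. Qed.

Lemma smooth_at_differentiable f x : smooth_at f x -> differentiable f x.
Proof. by move=> /smooth_at_near_differentiable/nbhs_singleton. Qed.

Lemma smooth_at_continuous f x : smooth_at f x -> {for x, continuous f}.
Proof. by move=> /smooth_at_differentiable/differentiable_continuous. Qed.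

Lemma smooth_at_derive f v x : smooth_at f x -> smooth_at ('D_v f) x.
Proof. by move=> sf k; have [_] := sf k.+1; apply. Qed.

(** The derivative of [1 / f] is [- f' / f ^ 2], a product of functions known to
    be one degree less regular, so that induction on the degree applies. *)
Lemma smooth_atV f x : f x != 0 -> smooth_at f x ->
  smooth_at (fun y => (f y)^-1) x.
Proof.
move=> fx sf k; have {sf}sf : forall k, Ck_at k f x by [].
have f0 : \forall y \near x, f y != 0.
  have cf : {for x, continuous f} by exact: smooth_at_continuous.
  have /cf : \forall u \near f x, u != 0.
    have := @open_nbhs_nbhs _ (f x) [set u : R | u != 0].
    apply; split=> //; exact: open_neq.
  by [].
elim: k => [|k IH].
  near=> y; apply: continuousV; first by near: y.
  by near: y; exact: (sf 0%N).
have fd : \forall y \near x, differentiable f y by exact: smooth_at_near_differentiable.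
split.
  by near=> y; apply: differentiableV; near: y.
move=> v; pose h : V -> R := fun y => (f y)^-1.
apply: (@Ck_at_ext _ _ _ (cst (-1) * (h * h) * 'D_v f)); last first.
  apply: Ck_atM; last by have [_] := sf k.+1; apply.
  by apply: Ck_atM; [exact: Ck_at_cst|exact: Ck_atM].
near=> y; rewrite [RHS]deriveV.
- by rewrite /h !fctE -exprVn expr2 mulN1r.
- by near: y.
- by apply: diff_derivable; near: y.
Unshelve. all: by end_near. Qed.

End SmoothCalculus.

Section ContinuousSum.
Variables (R : realType) (V W : normedModType R).

Lemma continuous_sumr (I : Type) (r : seq I) (F : I -> V -> W) x :
  (forall i, {for x, continuous (F i)}) ->
  {for x, continuous (fun y => \sum_(i <- r) F i y)}.
Proof.
move=> cF; elim: r => [|i r IH].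
  rewrite (_ : (fun _ => _) = cst 0); first exact: cvg_cst.
  by apply/funext => y; rewrite big_nil.
rewrite (_ : (fun _ => _) = F i \+ (fun y => \sum_(i <- r) F i y)).
  exact: continuousD.
by apply/funext => y; rewrite big_cons.
Qed.

Lemma continuous_scale_cst (f : V -> R) (w : W) x :
  {for x, continuous f} -> {for x, continuous (fun y => f y *: w)}.
Proof. by move=> cf; exact: cvgZr_tmp. Qed.

End ContinuousSum.

Section Coordinates.
Variables (R : realType) (m : nat).

Lemma row_sum_coord (T : Type) (g : T -> 'rV[R]_m) :
  g = fun y => \sum_j g y 0 j *: delta_mx 0 j.
Proof. by apply/funext => y; exact: row_sum_delta. Qed.

Lemma derive_coord (j : 'I_m) (v x : 'rV[R]_m) :
  'D_v (fun y : 'rV[R]_m => y 0 j) x = v 0 j.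
Proof.
have := @derive_mx R 'rV[R]_m 1 m id x v (@derivable_id _ _ _ _).
by rewrite derive_id => /(congr1 (fun M : 'rV[R]_m => M 0 j)); rewrite mxE => /esym.
Qed.

Lemma smooth_at_coord (j : 'I_m) (x : 'rV[R]_m) :
  smooth_at (fun y : 'rV[R]_m => y 0 j) x.
Proof.
case=> [|k].
  by near=> y; exact: coord_continuous.
split; first by near=> y; exact: differentiable_coord.
move=> v; apply: Ck_at_ext (Ck_at_cst k (v 0 j) x).
by near=> y; rewrite derive_coord.
Unshelve. all: by end_near. Qed.

Variable V : normedModType R.

Lemma continuous_row (g : V -> 'rV[R]_m) x :
  (forall j, {for x, continuous (fun y => g y 0 j)}) -> {for x, continuous g}.
Proof.
move=> cg; rewrite (row_sum_coord g).
apply: continuous_sumr => j; apply: continuous_scale_cst; exact: cg.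
Qed.

Lemma differentiable_row (g : V -> 'rV[R]_m) x :
  (forall j, differentiable (fun y => g y 0 j) x) -> differentiable g x.
Proof.
move=> dg; rewrite (row_sum_coord g).
rewrite (_ : (fun _ => _) = \sum_j (fun y => g y 0 j *: delta_mx 0 j)); last first.
  by apply/funext => y; rewrite fct_sumE.
by apply: differentiable_sum => j; exact: differentiableZl.
Qed.

Lemma derive_comp_row (f : 'rV[R]_m -> R) (g : V -> 'rV[R]_m) v x :
  (forall j, differentiable (fun y => g y 0 j) x) -> differentiable f (g x) ->
  'D_v (f \o g) x
  = \sum_j 'D_(delta_mx 0 j) f (g x) * 'D_v (fun y => g y 0 j) x.
Proof.
move=> dgj df; have dg := differentiable_row dgj.
rewrite deriveE; last exact: differentiable_comp.
rewrite diff_comp//= -[X in 'd f _ X]deriveE//.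
rewrite derive_mx; last exact: diff_derivable.
rewrite [X in 'd f _ X]row_sum_delta linear_sum; apply: eq_bigr => j _.
by rewrite linearZ/= mxE (deriveE _ df) mulrC.
Qed.

Lemma derive_sum_coord (f : 'rV[R]_m -> R) (v x : 'rV[R]_m) :
  differentiable f x -> 'D_v f x = \sum_j v 0 j * 'D_(delta_mx 0 j) f x.
Proof.
move=> df; rewrite deriveE// [X in 'd f _ X]row_sum_delta linear_sum.
by apply: eq_bigr => j _; rewrite linearZ /= deriveE.
Qed.

(** By induction on [k]: the chain rule writes a derivative of [f \o g] with
    partial derivatives of [f] composed with [g], to which the induction
    hypothesis applies, and derivatives of the components of [g]. *)
Lemma Ck_at_comp k (f : 'rV[R]_m -> R) (g : V -> 'rV[R]_m) x :
  (forall j, Ck_at k (fun y => g y 0 j) x) -> Ck_at k f (g x) ->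
  Ck_at k (f \o g) x.
Proof.
elim: k f x => [|k IH] f x.
  move=> cg cf.
  have cgx : {for x, continuous g}.
    by apply: continuous_row => j; exact: nbhs_singleton (cg j).
  have /cgx cf' := cf.
  have cgn : \forall y \near x, forall j, {for y, continuous (fun z => g z 0 j)}.
    exact: filter_forall.
  rewrite /=; near=> y; apply: continuous_comp; last by near: y.
  by apply: continuous_row; near: y.
move=> sg sf.
have cgx : {for x, continuous g}.
  apply: continuous_row => j; have [dg _] := sg j.
  by apply: differentiable_continuous; exact: nbhs_singleton dg.
have dgn : \forall y \near x, forall j, differentiable (fun z => g z 0 j) y.
  by apply: filter_forall => j; have [] := sg j.
have [dfn Df] := sf.
have /cgx dfn' := dfn.
split.
  near=> y; apply: differentiable_comp; last by near: y.
  by apply: differentiable_row; near: y.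
move=> v.
pose h := \sum_j ('D_(delta_mx 0 j) f \o g) * 'D_v (fun y => g y 0 j).
apply: (@Ck_at_ext _ _ _ h).
  near=> y; rewrite derive_comp_row; [|by near: y..].
  by rewrite /h fct_sumE.
apply: Ck_at_sum => j; apply: Ck_atM.
  by apply: IH (Df _) => j'; exact: Ck_atS.
by have [_] := sg j; apply.
Unshelve. all: by end_near. Qed.

Lemma smooth_at_comp (f : 'rV[R]_m -> R) (g : V -> 'rV[R]_m) x :
  smooth_vec_at g x -> smooth_at f (g x) -> smooth_at (f \o g) x.
Proof. by move=> sg sf k; apply: Ck_at_comp => // j; exact: sg. Qed.

Lemma smooth_vec_at_continuous (g : V -> 'rV[R]_m) x :
  smooth_vec_at g x -> {for x, continuous g}.
Proof.
by move=> sg; apply: continuous_row => j; exact: smooth_at_continuous (sg j).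
Qed.

End Coordinates.

(** * Hadamard's lemma *)

Section UnitIntegral.
Variable R : realType.
Local Notation mu := (@lebesgue_measure R).
Implicit Types phi psi : R -> R.

Definition unit_integral phi : R := \int[mu]_(t in `[0, 1]) phi t.

Definition cont01 phi := forall t : R, 0 <= t <= 1 -> {for t, continuous phi}.

Lemma cont01_within phi : cont01 phi -> {within `[0, 1], continuous phi}.
Proof.
move=> cphi; apply: continuous_in_subspaceT => t /set_mem /=.
by rewrite in_itv; exact: cphi.
Qed.

Lemma cont01_integrable phi : cont01 phi -> mu.-integrable `[0, 1] (EFin \o phi).
Proof.
move=> cphi; apply: continuous_compact_integrable; first exact: segment_compact.
exact: cont01_within.
Qed.

Lemma unit_integralD phi psi : cont01 phi -> cont01 psi ->
  unit_integral (phi \+ psi) = unit_integral phi + unit_integral psi.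
Proof. by move=> cphi cpsi; rewrite /unit_integral RintegralD//; exact: cont01_integrable. Qed.

Lemma unit_integralB phi psi : cont01 phi -> cont01 psi ->
  unit_integral (phi \- psi) = unit_integral phi - unit_integral psi.
Proof. by move=> cphi cpsi; rewrite /unit_integral RintegralB//; exact: cont01_integrable. Qed.

Lemma unit_integralZ c phi : cont01 phi ->
  unit_integral (fun t => c * phi t) = c * unit_integral phi.
Proof. by move=> cphi; rewrite /unit_integral RintegralZl//; exact: cont01_integrable. Qed.

Lemma unit_integral_cst c : unit_integral (cst c) = c.
Proof.
rewrite /unit_integral (Rintegral_cst mu)//= lebesgue_measure_itv/= lte_fin ltr01.
by rewrite /= oppr0 addr0 mulr1.
Qed.

Lemma eq_unit_integral phi psi : (forall t : R, 0 <= t <= 1 -> phi t = psi t) ->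
  unit_integral phi = unit_integral psi.
Proof.
by move=> e; apply: eq_Rintegral => t /set_mem/=; rewrite in_itv; exact: e.
Qed.

Lemma cont01_sum (I : Type) (r : seq I) (F : I -> R -> R) :
  (forall i, cont01 (F i)) -> cont01 (fun t => \sum_(i <- r) F i t).
Proof. by move=> cF t t01; apply: continuous_sumr => i; exact: cF. Qed.

Lemma unit_integral_sum (I : Type) (r : seq I) (F : I -> R -> R) :
  (forall i, cont01 (F i)) ->
  unit_integral (fun t => \sum_(i <- r) F i t) = \sum_(i <- r) unit_integral (F i).
Proof.
move=> cF; elim: r => [|i r IH].
  rewrite big_nil -[RHS](unit_integral_cst 0).
  by apply: eq_unit_integral => t _; rewrite big_nil.
rewrite big_cons -IH -unit_integralD//; last exact: cont01_sum.
by apply: eq_unit_integral => t _; rewrite big_cons.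
Qed.

Lemma unit_integral_le C phi : cont01 phi ->
  (forall t : R, 0 <= t <= 1 -> `|phi t| <= C) -> `|unit_integral phi| <= C.
Proof.
move=> cphi bphi.
have cn : cont01 (fun t => `|phi t|).
  by move=> t t01; apply: cvg_norm; exact: cphi.
apply: le_trans (le_normr_Rintegral _ (cont01_integrable cphi)) _ => //.
rewrite -[leRHS]unit_integral_cst; apply: le_Rintegral => //.
- exact: cont01_integrable.
- by apply: cont01_integrable => t _; exact: cvg_cst.
Qed.

Lemma unit_integral_derive (F f : R -> R) : cont01 f ->
  (forall t : R, 0 <= t <= 1 -> is_derive t 1 F (f t)) ->
  unit_integral f = F 1 - F 0.
Proof.
move=> cf dF.
have cF t : 0 <= t <= 1 -> {for t, continuous F}.
  by move=> /dF [dt _]; apply/differentiable_continuous/derivable1_diffP.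
rewrite /unit_integral /Rintegral (@continuous_FTC2 _ f F)//.
- exact: cont01_within.
- split.
  + by move=> t; rewrite in_itv/= => /andP[t0 t1]; have [] := dF t _; rewrite ?ltW.
  + by apply/cvg_at_right_filter/cF; rewrite lexx ler01.
  + by apply/cvg_at_left_filter/cF; rewrite lexx ler01.
- move=> t; rewrite in_itv/= => /andP[t0 t1].
  have t01 : 0 <= t <= 1 by rewrite !ltW.
  by rewrite derive1E; have [_ ->] := dF t t01.
Qed.

End UnitIntegral.

Section DirectionalMVT.
Variables (R : realType) (V : normedModType R).
Implicit Types f : V -> R.

Lemma is_derive_segment f (z w : V) (s : R) : differentiable f (z + s *: w) ->
  is_derive s 1 (fun t => f (z + t *: w)) ('D_w f (z + s *: w)).
Proof.
move=> df.
have dl : is_diff s (fun t : R => z + t *: w) (0 + ( *:%R ^~ w)).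
  by apply: is_diffD.
have dc : differentiable (f \o (fun t : R => z + t *: w)) s.
  by apply: differentiable_comp.
apply: DeriveDef; first exact: diff_derivable.
rewrite (deriveE _ dc) diff_comp//= [X in 'd f _ X](_ : _ = w) ?deriveE//.
by rewrite diff_val /= add0r scale1r.
Qed.

Lemma directional_mvt f (z w : V) :
  (forall s, 0 <= s <= 1 -> differentiable f (z + s *: w)) ->
  exists2 c, 0 <= c <= 1 & f (z + w) - f z = 'D_w f (z + c *: w).
Proof.
move=> df.
have [||c] := @MVT R (fun s => f (z + s *: w)) (fun s => 'D_w f (z + s *: w)) 0 1 ltr01.
- move=> s; rewrite in_itv/= => /andP[s0 s1].
  by apply: is_derive_segment; apply: df; rewrite !ltW.
- apply: cont01_within => s s01; apply: differentiable_continuous.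
  by apply/derivable1_diffP; have [] := is_derive_segment (df s s01).
rewrite in_itv/= => /andP[c0 c1]; rewrite scale0r scale1r addr0 subr0 mulr1 => e.
by exists c => //; rewrite !ltW.
Qed.

(** For functions approximated by an affine map, once that map is subtracted. *)
Lemma differentiable_flat f x :
  (forall e, 0 < e -> \forall y \near x, `|f y - f x| <= e * `|y - x|) ->
  differentiable f x /\ 'd f x = 0 :> (V -> R).
Proof.
move=> fe.
have e : f \o shift x = cst (f x) + (\0 : {linear V -> R}) +o_ (0 : V) id.
  apply/eqaddoP => e e0; have := fe e e0; rewrite (near_shift 0 x) subr0.
  apply: filterS => y; rewrite !fctE /= addrK.
  by rewrite [_ + 0]addr0.
have c0 : continuous (\0 : {linear V -> R}) by move=> z; exact: cvg_cst.
have d0 := diff_unique c0 e.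
by split=> //; apply/diff_locallyP; rewrite d0; split.
Qed.

End DirectionalMVT.

Section Hadamard.
Variables (R : realType) (n : nat) (a : 'rV[R]_n) (r : R).
Hypothesis r_gt0 : 0 < r.
Implicit Types (f : 'rV[R]_n -> R) (m : nat).

Definition ray (t : R) (x : 'rV[R]_n) := a + t *: (x - a).

(** Averages of [f] along the segments issued from [a]; the weight keeps the
    family closed under differentiation. *)
Definition ray_mean m f (x : 'rV[R]_n) : R :=
  unit_integral (fun t => t ^+ m * f (ray t x)).

Definition smooth_on_ball f := forall x, ball a r x -> smooth_at f x.

Lemma ray_ball t x : 0 <= t <= 1 -> ball a r x -> ball a r (ray t x).
Proof.
move=> /andP[t0 t1]; rewrite -!ball_normE /= /ray => xr.
rewrite opprD addNKr normrN normrZ (ger0_norm t0) -normrN opprB.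
apply: le_lt_trans xr; exact: ler_piMl.
Qed.

Lemma ray_continuous x t : {for t, continuous (ray^~ x)}.
Proof.
apply: continuousD; first exact: cvg_cst.
by apply: cvgZr_tmp; exact: cvg_id.
Qed.

Lemma cont01_ray m f x : smooth_on_ball f -> ball a r x ->
  cont01 (fun t => t ^+ m * f (ray t x)).
Proof.
move=> sf xr t t01; apply: cvgM; first exact: exprn_continuous.
apply: continuous_comp; first exact: ray_continuous.
exact/smooth_at_continuous/sf/ray_ball.
Qed.

(** Uniformity in [t] comes from the compactness of the segment. *)
Lemma near_uniform_ray f x (e : R) : smooth_on_ball f -> ball a r x -> 0 < e ->
  \forall h \near (0 : 'rV[R]_n), forall t : R, 0 <= t <= 1 ->
    `|f (ray t x + h) - f (ray t x)| < e.
Proof.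
move=> sf xr e0.
have /compact_near_coveringP cpt := @segment_compact R 0 1.
suff : \forall h \near (0 : 'rV[R]_n), `[0, 1] `<=`
    (fun t : R => `|f (ray t x + h) - f (ray t x)| < e).
  by apply: filterS => h H t t01; apply: H; rewrite /= in_itv.
apply: (cpt _ (nbhs (0 : 'rV[R]_n)) (fun h t => `|f (ray t x + h) - f (ray t x)| < e)).
  move=> t; rewrite /= in_itv => t01.
  pose p := ray t x.
  have cf : {for p, continuous f} by exact/smooth_at_continuous/sf/ray_ball.
  have e2 : 0 < e / 2 by rewrite divr_gt0.
  have /cvgrPdist_lt/(_ _ e2) nf := cf.
  have c1 : (ray s.1 x) @[s --> (t, (0 : 'rV[R]_n))] --> p.
    exact: (cvg_comp fst (ray^~ x) cvg_fst (@ray_continuous x t)).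
  have c2 : (ray s.1 x + s.2) @[s --> (t, (0 : 'rV[R]_n))] --> p.
    by rewrite -[p]addr0; apply: cvgD c1 _; exact: cvg_snd.
  have n1 := c1 _ nf; have n2 := c2 _ nf.
  near=> s; rewrite -(subrKA (f p)) (splitr e).
  apply: le_lt_trans (ler_normD _ _) _; apply: ltrD.
    by rewrite distrC; near: s; exact: n2.
  by near: s; exact: n1.
Unshelve. all: by end_near. Qed.

Lemma sum_coord_mean m f x (y z : 'rV[R]_n) : smooth_on_ball f -> ball a r x ->
  \sum_j (y 0 j - z 0 j) * ray_mean m ('D_(delta_mx 0 j) f) x
  = unit_integral (fun t => t ^+ m * 'D_(y - z) f (ray t x)).
Proof.
move=> sf xr; pose h := y - z.
rewrite -/h (eq_bigr (fun j => h 0 j * ray_mean m ('D_(delta_mx 0 j) f) x)); last first.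
  by move=> j _; rewrite !mxE.
have sDf v : smooth_on_ball ('D_v f) by move=> w wr; exact/smooth_at_derive/sf.
rewrite (@eq_unit_integral _ _ (fun t => \sum_j h 0 j *
    (t ^+ m * 'D_(delta_mx 0 j) f (ray t x)))); last first.
  move=> t t01; rewrite derive_sum_coord; last first.
    exact/smooth_at_differentiable/sf/ray_ball.
  by rewrite mulr_sumr; apply: eq_bigr => j _; rewrite mulrCA.
rewrite unit_integral_sum => [|j t t01]; last first.
  apply: cvgM; first exact: cvg_cst.
  by have := @cont01_ray m _ x (sDf (delta_mx 0 j)) xr t t01.
apply: eq_bigr => j _; rewrite unit_integralZ//.
exact: (@cont01_ray m _ x (sDf (delta_mx 0 j)) xr).
Qed.

(** Differentiation under the integral sign. The increment of the integrand is
    a derivative at an intermediate point, which is uniformly close to the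
    derivative on the segment. *)
Lemma ray_mean_increment m f x (e : R) : smooth_on_ball f -> ball a r x -> 0 < e ->
  \forall y \near x,
    `|(ray_mean m f y
       - \sum_j (y 0 j - x 0 j) * ray_mean m.+1 ('D_(delta_mx 0 j) f) x)
      - ray_mean m f x| <= e * `|y - x|.
Proof.
move=> sf xr e0.
have sDf v : smooth_on_ball ('D_v f) by move=> y yr; exact/smooth_at_derive/sf.
(* each of the n coordinates contributes at most d; n.+1 also covers n = 0 *)
pose d := e / n.+1%:R.
have d0 : 0 < d by rewrite divr_gt0// ltr0n.
have : \forall h \near (0 : 'rV[R]_n), forall (j : 'I_n) (t : R), 0 <= t <= 1 ->
    `|'D_(delta_mx 0 j) f (ray t x + h) - 'D_(delta_mx 0 j) f (ray t x)| < d.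
  have nj (j : 'I_n) := near_uniform_ray (sDf (delta_mx 0 j)) xr d0.
  exact: filter_forall nj.
move=> /nbhs_ballP[q /= q0 Hq].
have nq : \forall y \near x, ball x q y by exact: nbhsx_ballx.
have nr : \forall y \near x, ball a r y.
  by apply: open_nbhs_nbhs; split => //; exact: ball_open.
near=> y.
have yr : ball a r y by near: y; exact: nr.
have yq : `|y - x| < q.
  by have : ball x q y; [near: y; exact: nq|rewrite -ball_normE/= distrC].
pose h := y - x.
rewrite sum_coord_mean// addrAC /ray_mean.
have cD : cont01 (fun t => t ^+ m.+1 * 'D_h f (ray t x)).
  exact: (cont01_ray (sDf h)).
have cy := @cont01_ray m f y sf yr; have cx := @cont01_ray m f x sf xr.
rewrite -unit_integralB// -unit_integralB//; last first.
  by move=> t t01; apply: cvgB; [exact: cy|exact: cx].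
apply: unit_integral_le.
  by move=> t t01; apply: cvgB; [apply: cvgB; [exact: cy|exact: cx]|exact: cD].
move=> t t01 /=.
have rE c : ray t x + c *: (t *: h) = ray t (x + c *: h).
  by rewrite /ray /h -addrA scalerA mulrC -scalerA -scalerDr addrAC.
have xc c : 0 <= c <= 1 -> ball a r (x + c *: h).
  move=> /andP[c0 c1]; rewrite -ball_normE /= in xr yr *.
  have -> : a - (x + c *: h) = (1 - c) *: (a - x) + c *: (a - y).
    by apply/rowP => j; rewrite /h !mxE; ring.
  apply: le_lt_trans (ler_normD _ _) _; rewrite !normrZ !ger0_norm ?subr_ge0//.
  have [->|cn] := eqVneq c 0; first by rewrite subr0 mul1r mul0r addr0.
  have cp : 0 < c by rewrite lt0r cn.
  have : c * `|a - y| < c * r by rewrite ltr_pM2l.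
  have : (1 - c) * `|a - x| <= (1 - c) * r by rewrite ler_wpM2l ?subr_ge0// ltW.
  by lra.
have [c c01 mvt] : exists2 c, 0 <= c <= 1 &
    f (ray t x + t *: h) - f (ray t x) = 'D_(t *: h) f (ray t x + c *: (t *: h)).
  apply: directional_mvt => s s01; rewrite rE.
  by apply/smooth_at_differentiable/sf/ray_ball => //; exact: xc.
have yE : ray t x + t *: h = ray t y.
  by have := rE 1; rewrite !scale1r /h subrKC.
have -> : t ^+ m * f (ray t y) - t ^+ m * f (ray t x) - t ^+ m.+1 * 'D_h f (ray t x)
    = t ^+ m * \sum_j (t * h 0 j) * ('D_(delta_mx 0 j) f (ray t x + c *: (t *: h))
                                     - 'D_(delta_mx 0 j) f (ray t x)).
  have dfx : differentiable f (ray t x) by exact/smooth_at_differentiable/sf/ray_ball.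
  rewrite -mulrBr -yE mvt derive_sum_coord; last first.
    by rewrite rE; apply/smooth_at_differentiable/sf/ray_ball => //; exact: xc.
  rewrite (derive_sum_coord h dfx) exprSr -mulrA -mulrBr; congr (_ * _).
  rewrite mulr_sumr -sumrB; apply: eq_bigr => j _.
  by rewrite mxE mulrBr mulrA.
have /andP[t0 t1] := t01; have /andP[c0 c1] := c01.
rewrite normrM (ger0_norm (exprn_ge0 _ t0)).
apply: le_trans (_ : 1 * \sum_(j < n) d * `|h| <= _); last first.
  rewrite mul1r sumr_const card_ord -mulr_natr /d -/h mulrAC ler_wpM2r//.
  by rewrite -mulrA ger_pMr// ler_pdivrMl ?ltr0n// mulr1 ler_nat.
apply: ler_pM => //; first exact: exprn_ge0.
  by rewrite exprn_ile1.
apply: le_trans (ler_norm_sum _ _ _) _; apply: ler_sum => j _.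
rewrite normrM mulrC; apply: ler_pM => //.
  apply/ltW/Hq => //; rewrite -ball_normE /= sub0r normrN !normrZ !ger0_norm//.
  apply: le_lt_trans yq; rewrite -/h mulrA ler_piMl// mulr_ile1//.
rewrite normrM (ger0_norm t0); apply: le_trans (_ : 1 * `|h| <= _); last by rewrite mul1r.
apply: ler_pM => //.
rewrite [leRHS]/Num.Def.normr/= mx_normrE.
exact: (le_bigmax _ (fun i => `|h i.1 i.2|) (0, j)).
Unshelve. all: by end_near. Qed.

(** [ray_mean_increment] says that the mean minus its linear part is flat. *)
Lemma ray_mean_derive m f y : smooth_on_ball f -> ball a r y ->
  differentiable (ray_mean m f) y /\
  forall v, 'D_v (ray_mean m f) y
            = \sum_j v 0 j * ray_mean m.+1 ('D_(delta_mx 0 j) f) y.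
Proof.
move=> sf yr.
pose c j := ray_mean m.+1 ('D_(delta_mx 0 j) f) y.
pose l : 'rV[R]_n -> R := fun z => \sum_j (z 0 j - y 0 j) * c j.
have lE : l = \sum_j (((fun z : 'rV[R]_n => z 0 j) - cst (y 0 j)) * cst (c j)).
  by apply/funext => z; rewrite fct_sumE.
have sl : smooth_at l y.
  rewrite lE; apply: smooth_at_sum => j; apply: smooth_atM; last exact: smooth_at_cst.
  by apply: smooth_atB; [exact: smooth_at_coord|exact: smooth_at_cst].
have dl := smooth_at_differentiable sl.
have ly : l y = 0 by rewrite /l big1// => j _; rewrite subrr mul0r.
have [|dG DG] := @differentiable_flat R _ (ray_mean m f - l) y.
  move=> e e0; have := ray_mean_increment m sf yr e0.
  by apply: filterS => z; rewrite !fctE ly subr0.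
have UE : ray_mean m f = (ray_mean m f - l) + l by rewrite subrK.
have dU : differentiable (ray_mean m f) y by rewrite UE; exact: differentiableD.
split=> // v; rewrite UE deriveD; try exact: diff_derivable.
rewrite (deriveE _ dG) DG add0r lE.
rewrite derive_sum => [|j]; last first.
  apply/diff_derivable/smooth_at_differentiable/smooth_atM; last exact: smooth_at_cst.
  by apply: smooth_atB; [exact: smooth_at_coord|exact: smooth_at_cst].
apply: eq_bigr => j _.
have dc : differentiable (fun z : 'rV[R]_n => z 0 j) y by exact: differentiable_coord.
rewrite deriveM; [|apply: diff_derivable..]; [|exact: differentiableB|exact: differentiable_cst].
rewrite derive_cst scaler0 add0r deriveB; [|exact: diff_derivable..].
by rewrite derive_cst subr0 derive_coord mulrC.
Qed.

(** The derivatives of a weighted mean of [f] are combinations of weighted means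
    of derivatives of [f], whence the induction on the degree of regularity. *)
Lemma smooth_on_ray_mean m f : smooth_on_ball f -> smooth_on_ball (ray_mean m f).
Proof.
move=> sf x xr k; elim: k m f sf x xr => [|k IH] m f sf x xr.
  have nr : \forall y \near x, ball a r y.
    by apply: open_nbhs_nbhs; split => //; exact: ball_open.
  rewrite /=; near=> y; apply: differentiable_continuous.
  have yr : ball a r y by near: y; exact: nr.
  by have [] := ray_mean_derive m sf yr.
have nr : \forall y \near x, ball a r y.
  by apply: open_nbhs_nbhs; split => //; exact: ball_open.
split.
  near=> y; have yr : ball a r y by near: y; exact: nr.
  by have [] := ray_mean_derive m sf yr.
move=> v; pose g j := ray_mean m.+1 ('D_(delta_mx 0 j) f).
apply: (@Ck_at_ext _ _ _ (\sum_j cst (v 0 j) * g j)).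
  near=> y; have yr : ball a r y by near: y; exact: nr.
  by have [_ ->] := ray_mean_derive m sf yr; rewrite fct_sumE.
apply: Ck_at_sum => j; apply: Ck_atM; first exact: Ck_at_cst.
by apply: IH => // y yr; exact/smooth_at_derive/sf.
Unshelve. all: by end_near. Qed.

(** The increment of [f] along the segment from [a] to [x] is the integral of its
    derivative in the direction [x - a], which is linear in [x - a] with
    coefficients the means of the partial derivatives. *)
Lemma hadamard f : smooth_on_ball f ->
  exists g : 'I_n -> 'rV[R]_n -> R,
    [/\ forall j, smooth_on_ball (g j),
        forall j, g j a = 'D_(delta_mx 0 j) f a
      & forall x, ball a r x -> f x = f a + \sum_j (x 0 j - a 0 j) * g j x].
Proof.
move=> sf; exists (fun j => ray_mean 0 ('D_(delta_mx 0 j) f)).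
have sDf v : smooth_on_ball ('D_v f) by move=> y yr; exact/smooth_at_derive/sf.
split=> [j|j|x xr]; first exact: smooth_on_ray_mean.
  rewrite -[RHS]unit_integral_cst; apply: eq_unit_integral => t _.
  by rewrite mul1r /ray subrr scaler0 addr0.
rewrite sum_coord_mean//.
have c01 := @cont01_ray 0 _ x (sDf (x - a)) xr.
have dr (t : R) : 0 <= t <= 1 ->
    is_derive t 1 (fun s => f (ray s x)) (t ^+ 0 * 'D_(x - a) f (ray t x)).
  move=> t01; rewrite mul1r; apply: is_derive_segment.
  exact/smooth_at_differentiable/sf/ray_ball.
rewrite (unit_integral_derive c01 dr).
by rewrite /ray scale1r scale0r addr0 !subrKC.
Qed.

End Hadamard.

(** * Bump functions *)

Section RowNorm.
Variables (R : realType) (n : nat).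
Implicit Types x : 'rV[R]_n.

Lemma row_norm_lt x (r : R) : 0 < r -> (forall j, `|x 0 j| < r) -> `|x| < r.
Proof.
move=> r0 xr; rewrite [ltLHS]/Num.Def.normr/= mx_normrE.
by apply: bigmax_lt => // -[i j] _ /=; rewrite (ord1 i).
Qed.

Lemma le_coord_norm x j : `|x 0 j| <= `|x|.
Proof.
rewrite [leRHS]/Num.Def.normr/= mx_normrE.
exact: (le_bigmax _ (fun i => `|x i.1 i.2|) (0, j)).
Qed.

End RowNorm.

Section Bump.
Variable R : realType.

(** The powers of [1 / t] make the family closed under differentiation. *)
Definition flat m (t : R) : R := if 0 < t then t^-1 ^+ m * expR (- t^-1) else 0.

(** The exponential beats the powers of [1 / t]; the factor [t] that is gained
    makes the function continuous at 0. *)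
Lemma flat_bound m (t : R) : `|flat m t| <= m.+1%:R ^+ m.+1 * `|t|.
Proof.
rewrite /flat; case: ifPn => t0; last by rewrite normr0 mulr_ge0// exprn_ge0.
have N0 : 0 < m.+1%:R :> R by rewrite ltr0n.
have ti0 : 0 <= t^-1 by rewrite invr_ge0 ltW.
rewrite ger0_norm; last by rewrite mulr_ge0 ?expR_ge0// exprn_ge0.
rewrite gtr0_norm// expRN ler_pdivrMr ?expR_gt0//.
(* u is chosen so that expR t^-1 is the (m + 1)-st power of expR u, and u <= expR u *)
pose u := t^-1 / m.+1%:R.
have u0 : 0 < u by rewrite divr_gt0// invr_gt0.
have e1 : u ^+ m.+1 <= expR t^-1.
  have -> : expR t^-1 = expR u ^+ m.+1.
    by rewrite -expRM_natl /u mulrC divfK// gt_eqF.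
  apply: lerXn2r; rewrite ?nnegrE ?expR_ge0 ?(ltW u0)//.
  by apply: le_trans (expR_ge1Dx u); rewrite lerDr.
have -> : t^-1 ^+ m = m.+1%:R ^+ m.+1 * t * u ^+ m.+1.
  rewrite [_ * t]mulrC -mulrA -exprMn (mulrC _ u) /u divfK ?gt_eqF// mulrC.
  by rewrite exprSr -mulrA mulVf ?mulr1// gt_eqF.
by rewrite ler_pM2l// mulr_gt0// exprn_gt0.
Qed.

Lemma is_derive_flat m (t : R) :
  is_derive t 1 (flat m) (- m%:R * flat m.+1 t + flat m.+2 t).
Proof.
have [t0|t0|->] := ltgtP t 0.
- have n0 : \forall s \near t, cst 0 s = flat m s.
    near=> s; rewrite /flat ltNge ifN// negbK ltW//; near: s.
    exact: lt_nbhsl.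
  apply: (near_eq_is_derive n0).
  have -> : - m%:R * flat m.+1 t + flat m.+2 t = 0.
    by rewrite /flat ltNge (ltW t0)/= mulr0 addr0.
  exact: is_derive_cst.
- have n0 : \forall s \near t, s^-1 ^+ m * expR (- s^-1) = flat m s.
    near=> s; rewrite /flat ifT//; near: s.
    exact: lt_nbhsr.
  have tn : t != 0 by rewrite gt_eqF.
  apply: (near_eq_is_derive n0).
  have dV : is_derive t 1 (fun s : R => s^-1) (- t ^- 2 *: 1).
    exact: (@is_deriveV _ id).
  have dN := is_deriveN dV.
  have dX := is_deriveX m dV.
  have dE := @is_derive1_comp R expR (fun s => - s^-1) _ _ _ (is_derive_expR (- t^-1)) dN.
  rewrite (_ : (fun _ => _) = (GRing.inv : R -> R) ^+ m * (expR \o (fun s => - s^-1))).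
    apply: (is_derive_eq (is_deriveM dX dE)).
    rewrite /flat t0 /= !fctE /GRing.scale /= !mulr1 -!exprVn.
    by case: m {n0 dX} => [|m]; rewrite /= ?exprS; ring.
  by apply/funext => s; rewrite !fctE.
(* the difference quotient of flat m at 0 is flat m.+1 *)
- have c0 : (fun h : R => h^-1 *: (flat m (h *: 1 + 0) - flat m 0)) @ 0^' --> (0 : R).
    apply/cvgr0Pnorm_le => e e0; near=> h.
    have hn : h != 0 by near: h; exact: nbhs_dnbhs_neq.
    have -> : h^-1 *: (flat m (h *: 1 + 0) - flat m 0) = flat m.+1 h.
      rewrite [h *: 1]mulr1 addr0 /flat ltxx subr0 /GRing.scale /=.
      by case: ifPn => _; rewrite ?mulr0// exprS mulrA.
    apply: le_trans (flat_bound _ _) _.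
    rewrite -ler_pdivlMl ?exprn_gt0// ltW//; near: h; apply: dnbhs0_lt.
    by rewrite mulr_gt0// invr_gt0 exprn_gt0.
  have -> : - m%:R * flat m.+1 0 + flat m.+2 0 = 0 by rewrite /flat ltxx mulr0 addr0.
  apply: DeriveDef; first by apply/cvg_ex; exists 0.
  exact: cvg_lim c0.
Unshelve. all: by end_near. Qed.

Lemma flat_gt0 m t : 0 < t -> 0 < flat m t.
Proof. by move=> t0; rewrite /flat t0 mulr_gt0 ?expR_gt0// exprn_gt0// invr_gt0. Qed.

Lemma flat_ge0 m t : 0 <= flat m t.
Proof. by have [/(flat_gt0 m)/ltW//|t0] := ltP 0 t; rewrite /flat ltNge t0. Qed.

Lemma flat_eq0 m t : t <= 0 -> flat m t = 0.
Proof. by move=> t0; rewrite /flat ltNge t0. Qed.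

(** [smooth_at_comp] is about functions of row vectors, so its induction is redone
    here; it runs over all [m] at once, because the derivative of [flat m] involves
    [flat m.+1] and [flat m.+2]. *)
Lemma smooth_at_flat (V : normedModType R) m (q : V -> R) x :
  smooth_at q x -> smooth_at (flat m \o q) x.
Proof.
move=> sq k; elim: k m => [|k IH] m.
all: have dq := smooth_at_near_differentiable sq.
all: have df t : differentiable (flat m) t
  by apply/derivable1_diffP; have [] := is_derive_flat m t.
  rewrite /=; near=> y; apply: differentiable_continuous.
  by apply: differentiable_comp => //; near: y.
split; first by near=> y; apply: differentiable_comp => //; near: y.
move=> v; apply: (@Ck_at_ext _ _ _ ('D_v q * (cst (- m%:R) * (flat m.+1 \o q)
   + (flat m.+2 \o q)))).
  near=> y; have dqy : differentiable q y by near: y.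
  have dc : differentiable (flat m \o q) y by exact: differentiable_comp.
  have -> : 'D_v (flat m \o q) y = 'd (flat m) (q y) ('d q y v).
    by have dE := diff_comp dqy (df (q y)); rewrite (deriveE _ dc) dE.
  rewrite fctE (deriveE _ dqy).
  have [/derivable1_diffP _ fE] := is_derive_flat m (q y).
  have -> : 'd q y v = 'd q y v *: (1 : R) by rewrite [RHS]mulr1.
  rewrite linearZ -[X in _ = _ *: X]deriveE// fE /GRing.scale /= mulr1.
  by rewrite !fctE.
apply: Ck_atM; first by have [_] := sq k.+1; apply.
apply: Ck_atD; last exact: IH.
by apply: Ck_atM; [exact: Ck_at_cst|exact: IH].
Unshelve. all: by end_near. Qed.

(** With [s] twice the squared Euclidean distance to [a] divided by [r ^ 2], the
    bump is [p / (p + q)], where [p] vanishes for [s >= 2] and [q] for [s <= 1].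
    Outside the ball of radius [r], which is one for the sup norm, the Euclidean
    distance is at least [r]. *)
Lemma bump_exists n (a : 'rV[R]_n) (r : R) : 0 < r ->
  exists b : 'rV[R]_n -> R, [/\ forall x, smooth_at b x,
    \forall x \near a, b x = 1 & forall x, ~ ball a r x -> b x = 0].
Proof.
move=> r0.
pose s : 'rV[R]_n -> R := \sum_j
  (cst (2 / r ^+ 2) * ((fun x : 'rV[R]_n => x 0 j) - cst (a 0 j))
                     * ((fun x : 'rV[R]_n => x 0 j) - cst (a 0 j))).
have ss x : smooth_at s x.
  have sc j : smooth_at ((fun x : 'rV[R]_n => x 0 j) - cst (a 0 j)) x.
    by apply: smooth_atB; [exact: smooth_at_coord|exact: smooth_at_cst].
  apply: smooth_at_sum => j; apply: smooth_atM => //; apply: smooth_atM => //.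
  exact: smooth_at_cst.
have sE x : s x = \sum_j 2 / r ^+ 2 * (x 0 j - a 0 j) ^+ 2.
  by rewrite /s fct_sumE; apply: eq_bigr => j _; rewrite !fctE expr2 mulrA.
pose p := flat 0 \o (cst 2 - s); pose q := flat 0 \o (s - cst 1).
have sp x : smooth_at p x.
  by apply: smooth_at_flat; apply: smooth_atB => //; exact: smooth_at_cst.
have sq x : smooth_at q x.
  by apply: smooth_at_flat; apply: smooth_atB => //; exact: smooth_at_cst.
have pq x : p x + q x != 0.
  rewrite gt_eqF//; have [s2|s2] := ltP (s x) 2.
    by rewrite ltr_pwDl ?flat_ge0// flat_gt0// subr_gt0.
  by rewrite ltr_wpDl ?flat_ge0// flat_gt0// subr_gt0; apply: lt_le_trans s2; rewrite ltr1n.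
exists (p * (fun x => (p x + q x)^-1)); split.
- move=> x; apply: smooth_atM => //; apply: (@smooth_atV _ _ (p + q)); first exact: pq.
  exact: smooth_atD.
- have sa : s a = 0 by rewrite sE big1// => j _; rewrite subrr expr0n mulr0.
  have /cvgrPdist_lt/(_ 1 ltr01) := smooth_at_continuous (ss a).
  apply: filterS => x; rewrite sa sub0r normrN => sx.
  have qx : q x = 0.
    by rewrite /q /= flat_eq0// !fctE subr_le0 ltW//; apply: le_lt_trans sx; exact: ler_norm.
  by rewrite fctE qx addr0 mulfV//; have := pq x; rewrite qx addr0.
- move=> x xr; suff px : p x = 0 by rewrite fctE px mul0r.
  rewrite /p /= flat_eq0// !fctE subr_le0 sE.
  have [j xj] : exists j, r <= `|x 0 j - a 0 j|.
    apply: contrapT => /forallNP H; apply: xr; rewrite -ball_normE /=.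
    apply: row_norm_lt => // j; rewrite !mxE distrC ltNge; apply/negP; exact: H.
  rewrite (bigD1 j)//= -[leLHS]addr0 lerD//; last first.
    by apply: sumr_ge0 => i _; rewrite mulr_ge0 ?sqr_ge0// divr_ge0// exprn_ge0// ltW.
  have xj2 : r ^+ 2 <= (x 0 j - a 0 j) ^+ 2.
    by rewrite -[leRHS](ger0_norm (sqr_ge0 _)) normrX lerXn2r// nnegrE ltW.
  by rewrite mulrAC ler_pdivlMr ?exprn_gt0// ler_pM2l.
Qed.

End Bump.

(** * Functions, vector fields and forms on a manifold *)

Section ClosedBall.
Variables (R : realType) (n : nat).

Lemma near_forall_ord (V : topologicalType) m (P : 'I_m -> V -> Prop) (a : V) :
  (forall j, \forall x \near a, P j x) -> \forall x \near a, forall j, P j x.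
Proof. by move=> aP; exact: filter_forall. Qed.

Lemma compact_closed_ball (a : 'rV[R]_n) (r : R) : 0 < r -> compact (closed_ball a r).
Proof.
move=> r0; apply: bounded_closed_compact; last exact: closed_ball_closed.
rewrite closed_ballE//; exists (`|a| + r); split; first exact: num_real.
move=> N /ltW aN x; rewrite /closed_ball_ /= => xr.
rewrite -(subrKC a x) -normrN opprD opprB.
apply: le_trans (ler_normD _ _) _; rewrite normrN.
by apply: le_trans aN; rewrite lerD2l.
Qed.

End ClosedBall.

Section DerivationRules.
Variables (R : realType) (V : normedModType R).

Lemma derive_lin (c : R) (f g : V -> R) (x w : V) :
  derivable f x w -> derivable g x w ->
  'D_w (cst c * f + g) x = c * 'D_w f x + 'D_w g x.
Proof.
move=> df dg; have dc : derivable (cst c : V -> R) x w by exact: derivable_cst.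
have dcf := derivableM dc df.
by rewrite (deriveD dcf dg) (deriveM dc df) derive_cst scaler0 addr0.
Qed.

Lemma derive_leibniz (f g : V -> R) (x w : V) :
  derivable f x w -> derivable g x w ->
  'D_w (f * g) x = f x * 'D_w g x + g x * 'D_w f x.
Proof. by move=> df dg; rewrite (deriveM df dg). Qed.

End DerivationRules.

Section SmoothFunctionAlgebra.
Variables (R : realType) (M : atlas R).
Implicit Types (f g : cinf M) (q : M).

Lemma cinfP f : smooth_fun f.
Proof. by case: f => f /= /asboolP. Qed.

Lemma cinf_eqP f g : (forall q, f q = g q) -> f = g.
Proof. by move=> fg; apply/val_inj/funext. Qed.

Lemma cinfD f g q : (f + g) q = f q + g q. Proof. by []. Qed.
Lemma cinfN f q : (- f) q = - f q. Proof. by []. Qed.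
Lemma cinfB f g q : (f - g) q = f q - g q. Proof. by []. Qed.
Lemma cinfM f g q : (f * g) q = f q * g q. Proof. by []. Qed.
Lemma cinf0 q : (0 : cinf M) q = 0. Proof. by []. Qed.
Lemma cinf1 q : (1 : cinf M) q = 1. Proof. by []. Qed.
Lemma cinf_cstE c q : cinf_cst M c q = c. Proof. by []. Qed.
Definition cinfE := (cinfD, cinfN, cinfB, cinfM, cinf0, cinf1, cinf_cstE).

Lemma cinf_sumE (I : Type) (r : seq I) (P : pred I) (F : I -> cinf M) q :
  (\sum_(i <- r | P i) F i) q = \sum_(i <- r | P i) F i q.
Proof. by elim/big_rec2: _ => [|i y x _ <-]. Qed.

Lemma to_cinfE (h : M -> R) : smooth_fun h -> to_cinf h = h :> (M -> R).
Proof. by move=> sh; apply: (insubdK (0 : cinf M)); apply/asboolP. Qed.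

End SmoothFunctionAlgebra.

Section Charts.
Variables (R : realType) (M : atlas R) (hM : is_manifold M).
Local Notation n := (Defs.dim M).
Local Notation A := (cinf M).
Implicit Types (i : chart_index M) (x y : 'rV[R]_(Defs.dim M)) (p q : M).

Lemma dom_inv i x : cod_of i x -> dom_of i (inv_of i x).
Proof. by have [_ _ + _ _] := manifold_chart hM i; apply. Qed.

Lemma cod_map i p : dom_of i p -> cod_of i (map_of i p).
Proof. by have [_ + _ _ _] := manifold_chart hM i; apply. Qed.

Lemma map_ofK i p : dom_of i p -> inv_of i (map_of i p) = p.
Proof. by have [_ _ _ + _] := manifold_chart hM i; apply. Qed.

Lemma inv_ofK i x : cod_of i x -> map_of i (inv_of i x) = x.
Proof. by have [_ _ _ _ +] := manifold_chart hM i; apply. Qed.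

Lemma near_cod i x : cod_of i x -> \forall y \near x, cod_of i y.
Proof.
by move=> xi; apply: open_nbhs_nbhs; split=> //; exact: chart_cod_open (manifold_chart hM i).
Qed.

Lemma near_dom i j x : cod_of i x -> dom_of j (inv_of i x) ->
  \forall y \near x, dom_of j (inv_of i y).
Proof. by move=> xi xj; have [] := manifold_smooth hM xi xj. Qed.

Lemma smooth_transition i j x : cod_of i x -> dom_of j (inv_of i x) ->
  smooth_vec_at (map_of j \o inv_of i) x.
Proof. by move=> xi xj; have [] := manifold_smooth hM xi xj. Qed.

Lemma near_open i x (U : set M) : cod_of i x -> atlas_open U -> U (inv_of i x) ->
  \forall y \near x, U (inv_of i y).
Proof.
move=> xi oU Ux; have : \forall y \near x, (cod_of i `&` inv_of i @^-1` U) y.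
  by apply: open_nbhs_nbhs; split; [exact: oU|split].
by apply: filterS => y [].
Qed.

(** A compact piece of a chart is closed in [M], because [M] is Hausdorff. *)
Lemma near_notin_compact i (C : set 'rV[R]_n) j y0 :
  compact C -> C `<=` cod_of i -> cod_of j y0 ->
  (forall x, C x -> inv_of i x <> inv_of j y0) ->
  \forall y \near y0, forall x, C x -> inv_of i x <> inv_of j y.
Proof.
move=> /compact_near_coveringP cC Ci yj Cy.
apply: (cC _ (nbhs y0) (fun y x => inv_of i x <> inv_of j y)).
move=> x Cx; have [U [W [oU oW Ux Wy UW]]] := manifold_hausdorff hM (Cy x Cx).
have nU := near_open (Ci _ Cx) oU Ux; have nW := near_open yj oW Wy.
exists (U \o inv_of i, W \o inv_of j); first by split.
move=> [x' y'] /= [Ux' Wy'] e.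
have : (U `&` W) (inv_of i x') by split=> //; rewrite e.
by rewrite UW.
Qed.

Definition chart_ext i (h : 'rV[R]_n -> R) : M -> R :=
  fun q => if `[< dom_of i q >] then h (map_of i q) else 0.

Lemma chart_ext_inv i h x : cod_of i x -> chart_ext i h (inv_of i x) = h x.
Proof.
by move=> xi; rewrite /chart_ext ifT ?inv_ofK//; apply/asboolP; exact: dom_inv.
Qed.

(** Points of the compact image of the ball have a neighbourhood inside the chart;
    the complement of that image is open and the extension vanishes on it. *)
Lemma chart_ext_smooth i (a : 'rV[R]_n) (r : R) h : 0 < r ->
  closed_ball a r `<=` cod_of i ->
  (forall x, closed_ball a r x -> smooth_at h x) ->
  (forall x, ~ closed_ball a r x -> h x = 0) ->
  smooth_fun (chart_ext i h).
Proof.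
move=> r0 ri sh h0 j y0 yj.
have cC := @compact_closed_ball _ _ a r r0.
have [[x [Cx xy]]|noC] := pselect (exists x, closed_ball a r x /\ inv_of i x = inv_of j y0).
  have yi : dom_of i (inv_of j y0) by rewrite -xy; apply: dom_inv; exact: ri.
  have mapE : map_of i (inv_of j y0) = x by rewrite -xy inv_ofK//; exact: ri.
  apply: (@smooth_at_ext _ _ (h \o (map_of i \o inv_of j))); last first.
    by apply: smooth_at_comp; [exact: smooth_transition|rewrite /= mapE; exact: sh].
  have := near_dom yj yi; apply: filterS => y yiy.
  by rewrite /= /chart_ext ifT//; exact/asboolP.
have nC : forall x, closed_ball a r x -> inv_of i x <> inv_of j y0.
  by move=> x Cx xy; apply: noC; exists x.
apply: (@smooth_at_ext _ _ (cst 0)); last exact: smooth_at_cst.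
have := near_notin_compact cC ri yj nC; apply: filterS => y Cy.
rewrite /= /chart_ext; case: asboolP => // yiy; rewrite h0// => /Cy; apply.
by rewrite map_ofK.
Qed.

Lemma small_closed_ball i a (N : set 'rV[R]_n) : cod_of i a -> nbhs a N ->
  exists2 r, 0 < r & closed_ball a r `<=` cod_of i `&` N.
Proof.
move=> ai aN; have : nbhs a (cod_of i `&` N) by apply: filterI => //; exact: near_cod.
by move=> /nbhs_closedballP[r rN]; exists r%:num.
Qed.

(** The bump does not depend on the function [g] to be extended, so that the
    extension respects the algebraic operations on [g]. *)
Lemma extension_by_bump i a (N : set 'rV[R]_n) : cod_of i a -> nbhs a N ->
  exists b : 'rV[R]_n -> R, [/\ \forall x \near a, b x = 1,
    forall x, b x != 0 -> cod_of i x /\ N x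
  & forall g, (forall x, N x -> smooth_at g x) -> smooth_fun (chart_ext i (b * g))].
Proof.
move=> ai aN; have [r r0 rN] := small_closed_ball ai aN.
have [b [sb b1 b0]] := bump_exists a r0.
have bC x : ~ closed_ball a r x -> b x = 0.
  by move=> xr; apply: b0 => xb; apply: xr; exact: subset_closed_ball.
exists b; split=> // [x bx|g sg].
  have [/rN//|/bC bx0] := pselect (closed_ball a r x).
  by rewrite bx0 eqxx in bx.
apply: (chart_ext_smooth r0) => [x /rN[]//|x /rN[_ Nx]|x /bC bx].
  by apply: smooth_atM => //; exact: sg.
by rewrite fctE bx mul0r.
Qed.

Lemma function_extension i a (g : 'rV[R]_n -> R) : cod_of i a ->
  (\forall x \near a, smooth_at g x) ->
  exists G : A, \forall x \near a, G (inv_of i x) = g x.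
Proof.
move=> ai sg; have [b [b1 b0 sb]] := extension_by_bump ai sg.
exists (to_cinf (chart_ext i (b * g))); rewrite to_cinfE; last exact: sb.
near=> x; have xi : cod_of i x by near: x; exact: near_cod.
have bx : b x = 1 by near: x.
by rewrite chart_ext_inv// fctE bx mul1r.
Unshelve. all: by end_near. Qed.

Lemma bump_function i a (N : set 'rV[R]_n) : cod_of i a -> nbhs a N ->
  exists chi : A, (\forall x \near a, chi (inv_of i x) = 1) /\
    forall q, chi q != 0 -> dom_of i q /\ N (map_of i q).
Proof.
move=> ai aN; have [b [b1 b0 sb]] := extension_by_bump ai aN.
have s1 : smooth_fun (chart_ext i (b * cst 1)).
  by apply: sb => x _; exact: smooth_at_cst.
exists (to_cinf (chart_ext i (b * cst 1))); rewrite to_cinfE//; split.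
  near=> x; have xi : cod_of i x by near: x; exact: near_cod.
  have bx : b x = 1 by near: x.
  by rewrite chart_ext_inv// fctE bx mul1r.
move=> q; rewrite /chart_ext; case: asboolP => [qi|]; last by rewrite eqxx.
by rewrite fctE mulr1 => /b0[].
Unshelve. all: by end_near. Qed.

Section PointDerivations.
Variables (p : M) (v : A -> R^o).
Hypothesis vP : tangent_pred p v.

Lemma pderM f g : v (f * g) = f p * v g + g p * v f.
Proof. by have [_ ->] := vP. Qed.

Lemma pderD f g : v (f + g) = v f + v g.
Proof.
have [v1 _] := vP; have := v1 1 f g; rewrite mul1r.
by rewrite (_ : cinf_cst M 1 = 1) ?mul1r//; exact/val_inj.
Qed.

Lemma pder0 : v 0 = 0.
Proof. by apply: (@addrI _ (v 0)); rewrite -pderD !addr0. Qed.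

Lemma pderN f : v (- f) = - v f.
Proof. by apply: (@addrI _ (v f)); rewrite -pderD !subrr pder0. Qed.

Lemma pderB f g : v (f - g) = v f - v g.
Proof. by rewrite pderD pderN. Qed.

Lemma pder1 : v 1 = 0.
Proof.
by apply: (@addrI _ (v 1)); rewrite addr0 -[in RHS](mulr1 1) pderM !cinf1 !mul1r.
Qed.

Lemma pder_cst c : v (cinf_cst M c) = 0.
Proof.
have [v1 _] := vP; have := v1 c 1 0.
by rewrite mulr1 addr0 pder1 pder0 mulr0 addr0.
Qed.

Lemma pder_sum (I : Type) (r : seq I) (F : I -> A) :
  v (\sum_(i <- r) F i) = \sum_(i <- r) v (F i).
Proof.
elim: r => [|i r IH]; first by rewrite !big_nil pder0.
by rewrite !big_cons pderD IH.
Qed.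

End PointDerivations.

(** If [f - g] vanishes near the point, a bump [chi] supported there satisfies
    [(f - g) * chi = 0]; the Leibniz rule for this product gives the claim. *)
Lemma pder_local i a (v : A -> R^o) (f g : A) : cod_of i a ->
  tangent_pred (inv_of i a) v ->
  (\forall x \near a, f (inv_of i x) = g (inv_of i x)) -> v f = v g.
Proof.
move=> ai vP fg; have [chi [chi1 chi0]] := bump_function ai fg.
have e : (f - g) * chi = 0.
  apply: cinf_eqP => q; rewrite !cinfE.
  have [->|/chi0[qi]] := eqVneq (chi q) 0; first by rewrite mulr0.
  by rewrite map_ofK// => ->; rewrite subrr mul0r.
have := pderM vP (f - g) chi; rewrite e (pder0 vP) !cinfE.
rewrite (nbhs_singleton chi1) (nbhs_singleton fg) subrr mul0r add0r mul1r.
by rewrite (pderB vP) => /esym/eqP; rewrite subr_eq0 => /eqP.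
Qed.

(** The functions [u] are globally defined, and agree with the coordinates of the
    chart on a neighbourhood of the point only. *)
Definition coordinates_near i (a : 'rV[R]_n) (u : 'I_n -> A) : Prop :=
  \forall x \near a, forall j : 'I_n, u j (inv_of i x) = x 0 j.

Lemma coordinates_exist i a : cod_of i a -> exists u, coordinates_near i a u.
Proof.
move=> ai; have ex (j : 'I_n) : exists G : A,
    \forall x \near a, G (inv_of i x) = x 0 j.
  apply: (function_extension (g := fun x : 'rV[R]_n => x 0 j)) => //.
  by near=> x; exact: smooth_at_coord.
have [u uP] := choice ex; exists u.
exact: (near_forall_ord uP).
Unshelve. all: by end_near. Qed.

(** By Hadamard's lemma [f] is, near [p = inv_of i a], a constant plus the sum of
    the [(u j - u j p) * G j], where [G j p] is the [j]-th partial derivative. *)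
Lemma pder_coord i a u (v : A -> R^o) (f : A) : cod_of i a ->
  coordinates_near i a u -> tangent_pred (inv_of i a) v ->
  v f = \sum_j v (u j) * 'D_(delta_mx 0 j) (f \o inv_of i) a.
Proof.
move=> ai ua vP; have [r r0 ra] := small_closed_ball ai (near_cod ai).
have bC x : ball a r x -> cod_of i x by move=> /subset_closed_ball/ra[].
have sf : smooth_on_ball a r (f \o inv_of i).
  by move=> x /bC; exact: cinfP.
have [g [sg ga fE]] := hadamard sf.
have nb : \forall x \near a, ball a r x by exact: nbhsx_ballx.
have ex (j : 'I_n) : exists G : A, \forall x \near a, G (inv_of i x) = g j x.
  by apply: function_extension => //; near=> x; apply: sg; near: x.
have [G GP] := choice ex.
have nG : \forall x \near a, forall j : 'I_n, G j (inv_of i x) = g j x.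
  exact: (near_forall_ord GP).
have GA j : G j (inv_of i a) = 'D_(delta_mx 0 j) (f \o inv_of i) a.
  by rewrite (nbhs_singleton nG) ga.
have uA j : u j (inv_of i a) = a 0 j by rewrite (nbhs_singleton ua).
rewrite (@pder_local i a v f (cinf_cst M (f (inv_of i a))
    + \sum_j (u j - cinf_cst M (a 0 j)) * G j))//.
  rewrite (pderD vP) (pder_cst vP) add0r (pder_sum vP); apply: eq_bigr => j _.
  rewrite (pderM vP) !cinfE uA subrr mul0r add0r GA mulrC.
  by rewrite (pderB vP) (pder_cst vP) subr0.
near=> x; have xr : ball a r x by near: x.
rewrite cinfD cinf_sumE cinf_cstE.
have := fE x xr; rewrite /= => ->; congr (_ + _); apply: eq_bigr => j _.
transitivity ((u j (inv_of i x) - a 0 j) * G j (inv_of i x)); last by [].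
congr ((_ - _) * _).
  by apply/esym; move: j; near: x.
by apply/esym; move: j; near: x.
Unshelve. all: by end_near. Qed.

Lemma coord_tangent_pred i x (w : 'rV[R]_n) : cod_of i x ->
  tangent_pred (inv_of i x) (fun f : A => 'D_w (f \o inv_of i) x : R^o).
Proof.
move=> xi.
have df (f : A) : derivable (f \o inv_of i) x w.
  by apply/diff_derivable/smooth_at_differentiable/cinfP.
split=> [c f g|f g].
  have -> : (cinf_cst M c * f + g) \o inv_of i
      = cst c * (f \o inv_of i) + (g \o inv_of i) by [].
  exact: derive_lin.
have -> : (f * g) \o inv_of i = (f \o inv_of i) * (g \o inv_of i) by [].
exact: derive_leibniz.
Qed.

Lemma coord_vectorE i p (j : 'I_n) f : dom_of i p ->
  coord_vector i p j f = 'D_(delta_mx 0 j) (f \o inv_of i) (map_of i p).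
Proof.
move=> pi; rewrite /coord_vector insubdK//; apply/asboolP.
by have := coord_tangent_pred (delta_mx 0 j) (cod_map pi); rewrite map_ofK.
Qed.

Definition frame_near i (a : 'rV[R]_n) (E : 'I_n -> vfield M) : Prop :=
  \forall x \near a, forall (j : 'I_n) (f : A),
    E j f (inv_of i x) = 'D_(delta_mx 0 j) (f \o inv_of i) x.

(** The same bump multiplies all functions, so the cut-off partial derivatives are
    again derivations. *)
Lemma frame_exists i a : cod_of i a -> exists E, frame_near i a E.
Proof.
move=> ai; have [b [b1 b0 sb]] := extension_by_bump ai (near_cod ai).
pose e (j : 'I_n) (f : A) : M -> R :=
  chart_ext i (b * 'D_(delta_mx 0 j) (f \o inv_of i)).
have se (j : 'I_n) f : smooth_fun (e j f).
  by apply: sb => x xi; apply: smooth_at_derive; exact: cinfP.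
have eE (j : 'I_n) f q : e j f q = if `[< dom_of i q >] then
    b (map_of i q) * 'D_(delta_mx 0 j) (f \o inv_of i) (map_of i q) else 0 by [].
have tE (j : 'I_n) f q : to_cinf (e j f) q = e j f q by rewrite (to_cinfE (se j f)).
have De (j : 'I_n) : derivation (fun f : A => to_cinf (e j f) : A^o).
  split=> [c f g|f g]; apply: cinf_eqP => q.
    transitivity (c * e j f q + e j g q); last by rewrite -!tE.
    rewrite tE !eE; case: asboolP => [qi|_]; last by rewrite mulr0 addr0.
    have [-> _] := coord_tangent_pred (delta_mx 0 j) (cod_map qi).
    by ring.
  transitivity (f q * e j g q + g q * e j f q); last by rewrite -!tE.
  rewrite tE !eE; case: asboolP => [qi|_]; last by rewrite !mulr0 addr0.
  have [_ ->] := coord_tangent_pred (delta_mx 0 j) (cod_map qi).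
  by rewrite map_ofK//; ring.
have De' (j : 'I_n) : (fun f : A => to_cinf (e j f) : A^o) \in @derivationb R M by apply/asboolP.
exists (fun j : 'I_n => VField (De' j)); rewrite /frame_near; near=> x => j f /=.
have xi : cod_of i x by near: x; exact: near_cod.
have bx : b x = 1 by near: x.
by rewrite tE eE ifT ?inv_ofK ?bx ?mul1r//; apply/asboolP; exact: dom_inv.
Unshelve. all: by end_near. Qed.

Lemma vfield_at_pred (X : vfield M) p : tangent_pred p (fun f : A => X f p : R^o).
Proof. exact/asboolP/(vfield_at_subproof X p). Qed.

Lemma vfield_eqP (X Y : vfield M) : (forall f, X f = Y f) -> X = Y.
Proof. by move=> XY; apply/val_inj/funext. Qed.

Lemma form_eqP (alpha beta : one_form M) : (forall X, alpha X = beta X) -> alpha = beta.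
Proof. by move=> ab; apply/val_inj/funext. Qed.

Lemma vfield_sumE (I : Type) (r : seq I) (F : I -> vfield M) f :
  (\sum_(k <- r) F k) f = \sum_(k <- r) F k f.
Proof. by elim/big_rec2: _ => [|k y x _ <-]. Qed.

Lemma form_scale (alpha : one_form M) f (X : vfield M) : alpha (f *: X) = f * alpha X.
Proof.
have a0 : alpha 0 = 0.
  by have := formP alpha (-1) 0 0; rewrite scaler0 addr0 mulN1r addNr.
by rewrite -[_ *: _]addr0 formP a0 addr0.
Qed.

Lemma form_add (alpha : one_form M) (X Y : vfield M) : alpha (X + Y) = alpha X + alpha Y.
Proof. by rewrite -[X in LHS]scale1r formP mul1r. Qed.

Lemma form_opp (alpha : one_form M) (X : vfield M) : alpha (- X) = - alpha X.
Proof. by rewrite -scaleN1r form_scale mulN1r. Qed.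

Lemma form_sub (alpha : one_form M) (X Y : vfield M) : alpha (X - Y) = alpha X - alpha Y.
Proof. by rewrite form_add form_opp. Qed.

Lemma form_zero (alpha : one_form M) : alpha 0 = 0.
Proof. by rewrite -(scale0r 0) form_scale mul0r. Qed.

Lemma form_sum (alpha : one_form M) (I : Type) (r : seq I) (F : I -> vfield M) :
  alpha (\sum_(k <- r) F k) = \sum_(k <- r) alpha (F k).
Proof.
elim: r => [|k r IH]; first by rewrite !big_nil form_zero.
by rewrite !big_cons form_add IH.
Qed.

Lemma form_sumE (I : Type) (r : seq I) (F : I -> one_form M) X :
  (\sum_(k <- r) F k) X = \sum_(k <- r) F k X.
Proof. by elim/big_rec2: _ => [|k y x _ <-]. Qed.

(** On the chart this is the expansion of [X] in the coordinate frame; the cut-off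
    [chi] turns it into an identity of global fields. *)
Lemma local_generators p : exists (chi : A) (u : 'I_n -> A) (E : 'I_n -> vfield M),
  chi p = 1 /\ forall X : vfield M, chi *: X = \sum_j X (u j) *: E j.
Proof.
have [i pi] := manifold_cover hM p; have ai := cod_map pi.
have [u uP] := coordinates_exist ai; have [E EP] := frame_exists ai.
have nN : \forall x \near map_of i p, coordinates_near i x u /\
    forall (j : 'I_n) (f : A), E j f (inv_of i x) = 'D_(delta_mx 0 j) (f \o inv_of i) x.
  by apply: filterI; [exact: near_join uP|exact: EP].
have [chi [chi1 chi0]] := bump_function ai nN.
exists chi, u, (fun j : 'I_n => chi *: E j); split.
  by have := nbhs_singleton chi1; rewrite map_ofK.
move=> X; apply: vfield_eqP => f; rewrite vfield_sumE; apply: cinf_eqP => q.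
rewrite cinf_sumE.
transitivity (chi q * X f q); first by [].
rewrite (eq_bigr (fun j => chi q * (X (u j) q * E j f q))); last first.
  by move=> j _; rewrite mulrCA.
rewrite -mulr_sumr; have [->|/chi0[qi [uq Eq]]] := eqVneq (chi q) 0.
  by rewrite !mul0r.
congr (_ * _); have := vfield_at_pred X q.
rewrite -{1}(map_ofK qi) => Xq.
rewrite (pder_coord f (cod_map qi) uq Xq); apply: eq_bigr => j _.
by rewrite -Eq map_ofK.
Qed.

Lemma form_local_generators (chi : A) (u : 'I_n -> A) (E : 'I_n -> vfield M)
    (beta : one_form M) : (forall X : vfield M, chi *: X = \sum_j X (u j) *: E j) ->
  chi *: beta = \sum_j beta (E j) *: dform (u j).
Proof.
move=> chiE; apply: form_eqP => X; rewrite form_sumE.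
transitivity (chi * beta X); first by [].
rewrite -form_scale chiE form_sum; apply: eq_bigr => j _; rewrite form_scale.
by rewrite mulrC.
Qed.

(** After multiplication by a function equal to 1 at [p], every form is a
    combination of exact ones by [form_local_generators]. *)
Lemma linear_exact_eq (V : lmodType A) (S T : one_form M -> V) :
  (forall f alpha beta, S (f *: alpha + beta) = f *: S alpha + S beta) ->
  (forall f alpha beta, T (f *: alpha + beta) = f *: T alpha + T beta) ->
  (forall f, S (dform f) = T (dform f)) ->
  forall beta p, exists2 chi : A, chi p = 1 & chi *: S beta = chi *: T beta.
Proof.
have lin0 (U : one_form M -> V) :
    (forall f alpha beta, U (f *: alpha + beta) = f *: U alpha + U beta) ->
    U 0 = 0 /\ forall beta (chi : A) (u : 'I_n -> A) (E : 'I_n -> vfield M),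
    (forall X : vfield M, chi *: X = \sum_j X (u j) *: E j) ->
    chi *: U beta = \sum_j beta (E j) *: U (dform (u j)).
  move=> lU; have U0 : U 0 = 0.
    by have := lU (-1) 0 0; rewrite scaler0 addr0 scaleN1r addNr.
  split=> // beta chi u E chiE.
  rewrite -[LHS]addr0 -U0 -lU addr0 (form_local_generators beta chiE).
  elim: (index_enum _) => [|j r IH]; first by rewrite !big_nil.
  by rewrite !big_cons lU IH.
move=> lS lT ST beta p; have [chi [u [E [chi1 chiE]]]] := local_generators p.
exists chi => //; have [_ SE] := lin0 S lS; have [_ TE] := lin0 T lT.
rewrite (SE _ _ _ _ chiE) (TE _ _ _ _ chiE).
by apply: eq_bigr => j _; rewrite ST.
Qed.

(** The derivation [f |-> T (df)] represents [T]: both sides are linear and agree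
    on exact forms. *)
Lemma vfield_ofE (T : one_form M -> A) :
  (forall f alpha beta, T (f *: alpha + beta) = f * T alpha + T beta) ->
  forall beta : one_form M, beta (vfield_of T) = T beta.
Proof.
move=> lT; suff [Z ZT] : exists Z : vfield M, forall beta : one_form M, beta Z = T beta.
  by move=> beta; rewrite /vfield_of; case: xgetP => [Y _ ->//|/(_ Z)].
have dD : derivation (fun f : A => T (dform f) : A^o).
  split=> [c f g|f g].
    rewrite -lT; congr T; apply: form_eqP => X.
    by have [X1 _] := vfieldP X; apply: X1.
  have T0 : T 0 = 0 by have := lT (-1) 0 0; rewrite scaler0 addr0 mulN1r addNr.
  rewrite -[X in _ + X]addr0 -T0 -!lT; congr T; apply: form_eqP => X.
  by have [_ X2] := vfieldP X; rewrite addr0; apply: X2.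
have dD' : (fun f : A => T (dform f) : A^o) \in @derivationb R M by apply/asboolP.
exists (VField dD') => beta; apply: cinf_eqP => p.
have [] := @linear_exact_eq A^o (fun alpha : one_form M => alpha (VField dD')) T _ _ _ beta p.
- by [].
- exact: lT.
- by [].
move=> chi chi1 /(congr1 (fun f : A => f p)).
change (chi p * beta (VField dD') p = chi p * T beta p -> beta (VField dD') p = T beta p).
by rewrite chi1 !mul1r.
Qed.

(** After multiplication by a function equal to 1 at [p], a field that vanishes
    at [p] is a combination of fields with coefficients that vanish at [p]. *)
Lemma linear_vanishing_at (T : vfield M -> A) (X : vfield M) p :
  (forall f Y Z, T (f *: Y + Z) = f * T Y + T Z) ->
  (forall f, X f p = 0) -> T X p = 0.
Proof.
move=> lT X0; have [chi [u [E [chi1 chiE]]]] := local_generators p.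
have T0 : T 0 = 0 by have := lT (-1) 0 0; rewrite scaler0 addr0 mulN1r addNr.
have : (chi * T X) p = 0.
  rewrite -[chi * _]addr0 -T0 -lT addr0 chiE.
  elim: (index_enum _) => [|j r IH]; first by rewrite !big_nil T0.
  by rewrite big_cons lT cinfD IH cinfM X0 mul0r addr0.
by rewrite cinfM chi1 mul1r.
Qed.

End Charts.

(** * The Courant algebroid of a Poisson structure *)

Section LieDerivative.
Variables (R : realType) (M : atlas R).
Local Notation A := (cinf M).
Implicit Types (X Y Z : vfield M) (alpha : one_form M) (f g : A).

Lemma vfieldN X f : X (- f) = - X f.
Proof. by have [X1 _] := vfieldP X; apply: (@addrI _ (X f)); rewrite -vfieldD !subrr;
  apply: (@addrI _ (X 0)); rewrite -vfieldD !addr0. Qed.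

Lemma vfieldB X f g : X (f - g) = X f - X g.
Proof. by rewrite vfieldD vfieldN. Qed.

Lemma vfieldM X f g : X (f * g) = f * X g + g * X f.
Proof. by have [_] := vfieldP X. Qed.

Lemma vfield_cst X c : X (cinf_cst M c) = 0.
Proof. by apply: cinf_eqP => p; exact: pder_cst (vfield_at_pred X p) c. Qed.

Lemma form_lie_lie alpha X Y Z :
  alpha (lie (lie X Y) Z) = alpha (lie X (lie Y Z)) - alpha (lie Y (lie X Z)).
Proof.
rewrite -form_sub; congr (alpha _); apply: vfield_eqP => f.
transitivity (lie X (lie Y Z) f - lie Y (lie X Z) f); last by [].
by rewrite !lieE !vfieldB; ring.
Qed.

Lemma formDE alpha (beta : one_form M) X : (alpha + beta) X = alpha X + beta X.
Proof. by []. Qed.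

Lemma formZE f alpha X : (f *: alpha) X = f * alpha X.
Proof. by []. Qed.

Lemma vfield_form_eq X Y : (forall beta : one_form M, beta X = beta Y) -> X = Y.
Proof. by move=> XY; apply: vfield_eqP => f; exact: XY (dform f). Qed.

End LieDerivative.

Section Koszul.
Variables (R : realType) (M : atlas R) (hM : is_manifold M) (pi : bivector M).
Local Notation A := (cinf M).
Local Notation K := (koszul pi).
Implicit Types (X Y Z : vfield M) (alpha beta gamma : one_form M) (f g : A).

Lemma sharpD alpha beta : pi (alpha + beta) = pi alpha + pi beta.
Proof. by rewrite -[alpha in LHS]scale1r sharp_lin scale1r. Qed.

Lemma sharp0 : pi 0 = 0.
Proof. by apply: (@addrI _ (pi 0)); rewrite -sharpD !addr0. Qed.

Lemma sharpZ f alpha : pi (f *: alpha) = f *: pi alpha.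
Proof. by rewrite -[_ *: _]addr0 sharp_lin sharp0 addr0. Qed.

Lemma sharp_skew alpha beta : alpha (pi beta) = - beta (pi alpha).
Proof.
have := sharp_alt pi (alpha + beta); rewrite sharpD form_add !formDE !sharp_alt.
by rewrite add0r addr0 => /eqP; rewrite addrC addr_eq0 => /eqP.
Qed.

(** Skewness turns the exact term of the definition into the one of Cartan's
    formula, so this is [L_(pi alpha) beta - iota_(pi beta) (d alpha)]. A bracket
    in the second argument then enters the exact term through its anchor only. *)
Lemma koszulE alpha beta Y : K alpha beta Y =
  pi alpha (beta Y) - beta (lie (pi alpha) Y)
  - pi beta (alpha Y) + alpha (lie (pi beta) Y) + Y (alpha (pi beta)).
Proof.
transitivity (lie_form (pi alpha) beta Y - lie_form (pi beta) alpha Y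
  - Y (beta (pi alpha))); first by [].
rewrite (sharp_skew alpha) vfieldN.
transitivity ((pi alpha (beta Y) - beta (lie (pi alpha) Y))
  - (pi beta (alpha Y) - alpha (lie (pi beta) Y)) - Y (beta (pi alpha))); first by [].
by ring.
Qed.

Lemma koszul_skew alpha beta : K beta alpha = - K alpha beta.
Proof.
apply: form_eqP => Y; transitivity (- K alpha beta Y); last by [].
by rewrite !koszulE (sharp_skew beta) vfieldN; ring.
Qed.

Lemma koszul_linr f alpha beta gamma :
  K alpha (f *: beta + gamma) = f *: K alpha beta + (pi alpha f *: beta + K alpha gamma).
Proof.
apply: form_eqP => Y.
transitivity (f * K alpha beta Y + (pi alpha f * beta Y + K alpha gamma Y)); last by [].
rewrite !koszulE !formDE !formZE sharp_lin.
have -> : lie (f *: pi beta + pi gamma) Y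
    = f *: lie (pi beta) Y - Y f *: pi beta + lie (pi gamma) Y.
  apply: vfield_eqP => g.
  transitivity (f * lie (pi beta) Y g - Y f * pi beta g + lie (pi gamma) Y g); last by [].
  by rewrite !lieE !vfield_linE vfieldD vfieldM; ring.
rewrite !form_add form_opp !form_scale !vfield_linE !vfieldD !vfieldM.
by ring.
Qed.

Lemma koszul_linl f alpha beta gamma :
  K (f *: alpha + gamma) beta = f *: K alpha beta + (- pi beta f *: alpha + K gamma beta).
Proof.
apply: form_eqP => Y.
transitivity (f * K alpha beta Y + (- pi beta f * alpha Y + K gamma beta Y)); last by [].
have skE a b : K a b Y = - K b a Y by rewrite (koszul_skew b a).
rewrite skE koszul_linr.
transitivity (- (f * K beta alpha Y + (pi beta f * alpha Y + K beta gamma Y))); first by [].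
by rewrite (skE beta alpha) (skE beta gamma); ring.
Qed.

Lemma koszul_exact f g : K (dform f) (dform g) = dform (poisson_bracket pi f g).
Proof.
apply: form_eqP => Y; rewrite koszulE /poisson_bracket /bivector_eval.
rewrite (sharp_skew (dform f)) vfieldN.
transitivity (pi (dform f) (Y g) - lie (pi (dform f)) Y g - pi (dform g) (Y f)
  + lie (pi (dform g)) Y f - Y (pi (dform f) g)); first by [].
rewrite !lieE; transitivity (- Y (pi (dform g) f)); first by ring.
have -> : pi (dform g) f = - pi (dform f) g by exact: (sharp_skew (dform f)).
by rewrite vfieldN opprK.
Qed.

Lemma linear_exact0 (S : one_form M -> vfield M) :
  (forall f alpha beta, S (f *: alpha + beta) = f *: S alpha + S beta) ->
  (forall f, S (dform f) = 0) -> forall beta, S beta = 0.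
Proof.
move=> lS S0 beta; apply: vfield_eqP => f; apply: cinf_eqP => p.
have [|||chi chi1] := @linear_exact_eq _ _ hM _ S (fun _ => 0) _ _ _ beta p.
- exact: lS.
- by move=> *; rewrite scaler0 addr0.
- exact: S0.
move=> /(congr1 (fun X : vfield M => X f p)).
rewrite scaler0 => e.
have : chi p * S beta f p = 0 by exact: e.
by rewrite chi1 mul1r => ->.
Qed.

Hypothesis hpi : is_poisson pi.

(** On exact forms this is the Jacobi identity of the Poisson bracket; both sides
    obey the same Leibniz rules, so the defect is tensorial. *)
Lemma sharp_koszul alpha beta : pi (K alpha beta) = lie (pi alpha) (pi beta).
Proof.
pose P alpha beta := pi (K alpha beta) - lie (pi alpha) (pi beta).
have PE a b g : P a b g = pi (K a b) g - (pi a (pi b g) - pi b (pi a g)) by [].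
have Pl a f b c : P a (f *: b + c) = f *: P a b + P a c.
  apply: vfield_eqP => g; transitivity (f * P a b g + P a c g); last by [].
  rewrite !PE koszul_linr !sharp_lin !vfield_linE vfieldD vfieldM.
  by ring.
have Pr b f a c : P (f *: a + c) b = f *: P a b + P c b.
  apply: vfield_eqP => g; transitivity (f * P a b g + P c b g); last by [].
  rewrite !PE koszul_linl !sharp_lin !vfield_linE vfieldD vfieldM.
  by ring.
have Pex f b : P (dform f) b = 0.
  apply: (linear_exact0 (S := P (dform f))) => [|g]; first exact: Pl.
  apply: vfield_eqP => h; rewrite PE koszul_exact.
  have sk a c : pi (dform a) c = - pi (dform c) a by exact: (sharp_skew (dform c)).
  have := hpi f g h; rewrite /poisson_bracket /bivector_eval /=.
  set fg := pi (dform f) g => jac.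
  have {}jac : pi (dform f) (pi (dform g) h) + pi (dform g) (pi (dform h) f)
    + pi (dform h) fg = 0 by exact: jac.
  rewrite (sk fg) -[RHS]oppr0 -jac (sk h f) vfieldN.
  by ring.
apply/eqP; rewrite -subr_eq0; apply/eqP.
apply: (linear_exact0 (S := P^~ beta)) => [|f]; first exact: Pr.
exact: Pex.
Qed.

(** Cartan calculus: once [sharp_koszul] has removed the brackets from the anchors,
    only Lie derivatives along [pi alpha], [pi beta] and [pi gamma] are left. *)
Lemma koszul_jacobi alpha beta gamma Y :
  K alpha (K beta gamma) Y = K (K alpha beta) gamma Y + K beta (K alpha gamma) Y.
Proof.
rewrite !koszulE !sharp_koszul !form_lie_lie !lieE !(vfieldD, vfieldN).
ring.
Qed.

Lemma pi_lieE alpha Y gamma :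
  gamma (pi_lie pi alpha Y) = pi alpha (gamma Y) - K alpha gamma Y.
Proof.
apply: (vfield_ofE hM) => f b c.
transitivity (pi alpha (f * b Y + c Y) - (f * K alpha b Y
  + (pi alpha f * b Y + K alpha c Y))); first by rewrite koszul_linr.
by rewrite vfieldD vfieldM; ring.
Qed.

Lemma pi_diff_contractE X beta gamma :
  gamma (pi_diff_contract pi X beta) = pi_diff pi X beta gamma.
Proof.
apply: (vfield_ofE hM) => f b c; rewrite /pi_diff.
transitivity (pi beta (f * b X + c X) - (f * pi b (beta X) + pi c (beta X))
  - (f * K beta b X + (pi beta f * b X + K beta c X))).
  by rewrite koszul_linr sharp_lin.
by rewrite vfieldD vfieldM; ring.
Qed.

Local Notation C := (poisson_courant pi).
Implicit Types a b c : sect C.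

(** The vector field part of the Dorfman bracket is only known through its pairing
    with 1-forms, so identities between such parts are tested on all forms. *)
Lemma dorfman_formE a b gamma : gamma (dorfman a b).1 =
  pi a.2 (gamma b.1) - K a.2 gamma b.1
  - (pi b.2 (gamma a.1) - pi gamma (b.2 a.1) - K b.2 gamma a.1).
Proof. by rewrite /= form_sub pi_lieE pi_diff_contractE. Qed.

Lemma sect_eqP a b : (forall gamma, gamma a.1 = gamma b.1) ->
  (forall Y, a.2 Y = b.2 Y) -> a = b.
Proof.
move=> ab1 ab2; rewrite (surjective_pairing a) (surjective_pairing b); congr (_, _).
  exact: vfield_form_eq.
exact: form_eqP.
Qed.

Lemma koszul_koszul alpha beta gamma Y :
  K (K alpha beta) gamma Y = K alpha (K beta gamma) Y - K beta (K alpha gamma) Y.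
Proof. by rewrite koszul_jacobi addrK. Qed.

Lemma sharp_cst f alpha (c : R) : pi alpha (cinf_cst M c * f) = cinf_cst M c * pi alpha f.
Proof. by rewrite vfieldM vfield_cst mulr0 addr0. Qed.

Lemma koszul_cstr (c : R) alpha beta gamma Y :
  K alpha (cinf_cst M c *: beta + gamma) Y
  = cinf_cst M c * K alpha beta Y + K alpha gamma Y.
Proof.
transitivity (cinf_cst M c * K alpha beta Y
  + (pi alpha (cinf_cst M c) * beta Y + K alpha gamma Y)); first by rewrite koszul_linr.
by rewrite vfield_cst mul0r add0r.
Qed.

Lemma koszul_cstl (c : R) alpha beta gamma Y :
  K (cinf_cst M c *: alpha + gamma) beta Y
  = cinf_cst M c * K alpha beta Y + K gamma beta Y.
Proof.
transitivity (cinf_cst M c * K alpha beta Y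
  + (- pi beta (cinf_cst M c) * alpha Y + K gamma beta Y)); first by rewrite koszul_linl.
by rewrite vfield_cst oppr0 mul0r add0r.
Qed.

Lemma sect_lin1 f a b : (f *: a + b).1 = f *: a.1 + b.1. Proof. by []. Qed.
Lemma sect_lin2 f a b : (f *: a + b).2 = f *: a.2 + b.2. Proof. by []. Qed.
Lemma sectD1 a b : (a + b).1 = a.1 + b.1. Proof. by []. Qed.
Lemma sectD2 a b : (a + b).2 = a.2 + b.2. Proof. by []. Qed.
Lemma pairingE a b : pairing a b = a.2 b.1 + b.2 a.1. Proof. by []. Qed.
Lemma anchorE a : anchor a = pi a.2. Proof. by []. Qed.
Lemma dorfman2 a b : (dorfman a b).2 = K a.2 b.2. Proof. by []. Qed.

Lemma poisson_courant_jacobi a b c :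
  dorfman a (dorfman b c) = dorfman (dorfman a b) c + dorfman b (dorfman a c).
Proof.
apply: sect_eqP => [delta|Y]; last exact: koszul_jacobi.
rewrite sectD1 [RHS]form_add !dorfman_formE !dorfman2 !sharp_koszul.
(* from here on the bracket only enters through its Jacobi identity *)
move: koszul_koszul; move: (koszul pi) => k kk.
have kkE (x y z : one_form M) Y : k (k x y) z Y = k x (k y z) Y - k y (k x z) Y.
  exact: kk.
move: (a.1) (a.2) (b.1) (b.2) (c.1) (c.2) => a1 a2 b1 b2 c1 c2.
rewrite !kkE !lieE !(vfieldD, vfieldN).
ring.
Qed.

(** A linear form on pairs splits into a linear form on vector fields, which is a
    1-form by definition, and one on 1-forms, which is a vector field by
    [vfield_ofE]. *)
Lemma poisson_courant_nondegenerate (phi : sect C -> A) :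
  (forall f a b, phi (f *: a + b) = f * phi a + phi b) ->
  exists! a : sect C, forall b, pairing a b = phi b.
Proof.
move=> lphi; pose ph (Y : vfield M) (beta : one_form M) : A := phi (Y, beta).
have phE f Y beta Y' beta' :
    ph (f *: Y + Y') (f *: beta + beta') = f * ph Y beta + ph Y' beta'.
  exact: lphi f (Y, beta) (Y', beta').
have ph0 : ph 0 0 = 0.
  by have := phE (-1) 0 0 0 0; rewrite !scaler0 !addr0 mulN1r addNr.
have fX : form_pred (fun Y : vfield M => ph Y 0 : A^o).
  by move=> f X Y; rewrite -phE scaler0 addr0.
have fX' : (fun Y : vfield M => ph Y 0 : A^o) \in @form_predb R M by exact/asboolP.
have lT f alpha beta : ph 0 (f *: alpha + beta) = f * ph 0 alpha + ph 0 beta.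
  by rewrite -phE scaler0 addr0.
have XE := vfield_ofE hM lT.
have phD Y beta : ph Y 0 + ph 0 beta = ph Y beta.
  by rewrite -[ph Y 0]mul1r -phE scale1r scaler0 addr0 add0r.
exists (vfield_of (ph 0), Form fX'); split.
  by case=> Y beta; rewrite pairingE /= XE; exact: phD.
case=> X alpha aE; apply: sect_eqP => [gamma|Y].
  by have := aE (0, gamma); rewrite pairingE /= form_zero add0r XE => ->.
transitivity (phi (Y, 0)); first by [].
by rewrite -aE pairingE /= [X in _ + X](_ : _ = 0)// addr0.
Qed.

Lemma poisson_courant_is_courant : is_courant C.
Proof.
split.
- by move=> a b; rewrite !pairingE addrC.
- move=> f a b c; rewrite !pairingE sect_lin1 sect_lin2 formP formDE formZE.
  by ring.
- exact: poisson_courant_nondegenerate.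
- by move=> f a b; rewrite !anchorE sect_lin2 sharp_lin.
- move=> c a b d; apply: sect_eqP => [gamma|Y]; last exact: koszul_cstl.
  rewrite sect_lin1 [RHS]formP !dorfman_formE sect_lin1 sect_lin2.
  move: (a.1) (a.2) (b.1) (b.2) (d.1) (d.2) => a1 a2 b1 b2 d1 d2.
  rewrite (koszul_cstl c a2 gamma b2 d1) sharp_lin (formP d2) (formP (K d2 gamma)).
  by rewrite vfield_linE (formP gamma) !vfieldD !sharp_cst; ring.
- move=> c a b d; apply: sect_eqP => [gamma|Y]; last exact: koszul_cstr.
  rewrite sect_lin1 [RHS]formP !dorfman_formE sect_lin1 sect_lin2.
  move: (a.1) (a.2) (b.1) (b.2) (d.1) (d.2) => a1 a2 b1 b2 d1 d2.
  have -> : (cinf_cst M c *: a2 + b2) d1 = cinf_cst M c * a2 d1 + b2 d1 by [].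
  rewrite (koszul_cstl c a2 gamma b2 d1) sharp_lin (formP (K d2 gamma)).
  by rewrite (formP gamma) vfield_linE !vfieldD !sharp_cst; ring.
- exact: poisson_courant_jacobi.
- move=> a b c; rewrite !pairingE !dorfman_formE !dorfman2 anchorE vfieldD.
  have nE x y Y : K x y Y = - K y x Y by rewrite (koszul_skew y x).
  rewrite (nE c.2 b.2).
  ring.
- move=> a b c; rewrite pairingE sectD1 sectD2 (form_add c.2) formDE !dorfman_formE !dorfman2.
  have nE x y Y : K x y Y = - K y x Y by rewrite (koszul_skew y x).
  rewrite (nE b.2 a.2) anchorE pairingE vfieldD.
  by ring.
Qed.

End Koszul.

(** * The cotangent bundle as a manifold *)

Section AtlasTopology.
Variables (R : realType) (L : atlas R).
Hypothesis chartL : forall i : chart_index L, is_chart (chart_of i).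
Hypothesis smoothL : smooth_map (@id L).

Lemma atlas_openI (U V : set L) : atlas_open U -> atlas_open V -> atlas_open (U `&` V).
Proof.
move=> oU oV i; have -> : cod_of i `&` inv_of i @^-1` (U `&` V)
    = (cod_of i `&` inv_of i @^-1` U) `&` (cod_of i `&` inv_of i @^-1` V).
  by apply/seteqP; split=> x /= [] => [xi [Ux Vx]|[xi Ux] [_ Vx]].
by apply: openI; [exact: oU|exact: oV].
Qed.

Lemma atlas_open_chart (i : chart_index L) (W : set 'rV[R]_(Defs.dim L)) : open W ->
  atlas_open [set z | dom_of i z /\ W (map_of i z)].
Proof.
move=> oW j; rewrite openE => y [yj [yi Wy]].
have nj : \forall x \near y, cod_of j x.
  by apply: open_nbhs_nbhs; split=> //; exact: chart_cod_open (chartL j).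
have [ni si] := smoothL yj yi.
have nW : \forall x \near y, W (map_of i (inv_of j x)).
  apply: (smooth_vec_at_continuous si).
  by apply: open_nbhs_nbhs; split.
have : \forall x \near y, cod_of j x /\ (dom_of i (inv_of j x) /\ W (map_of i (inv_of j x))).
  by apply: filterI => //; apply: filterI.
by [].
Qed.

End AtlasTopology.

Section RowBlocks.
Variables (R : realType) (m n : nat).

Lemma smooth_lsubmx (x : 'rV[R]_(m + n)) : smooth_vec_at (lsubmx : _ -> 'rV[R]_m) x.
Proof.
move=> j; apply: smooth_at_ext (smooth_at_coord (lshift n j) x).
by near=> y; rewrite mxE.
Unshelve. all: by end_near. Qed.

Lemma smooth_rsubmx (x : 'rV[R]_(m + n)) : smooth_vec_at (rsubmx : _ -> 'rV[R]_n) x.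
Proof.
move=> j; apply: smooth_at_ext (smooth_at_coord (rshift m j) x).
by near=> y; rewrite mxE.
Unshelve. all: by end_near. Qed.

Lemma ball_row_mx (a a' : 'rV[R]_m) (b b' : 'rV[R]_n) (e : R) : 0 < e ->
  ball a e a' -> ball b e b' -> ball (row_mx a b) e (row_mx a' b').
Proof.
rewrite -!ball_normE /= => e0 aa bb; apply: row_norm_lt => // j.
rewrite -(splitK j); case: (fintype.split j) => k; rewrite /= !mxE.
  rewrite !(unsplitK (inl _)) /=; apply: le_lt_trans aa.
  by have := le_coord_norm (a - a') k; rewrite !mxE.
rewrite !(unsplitK (inr _)) /=; apply: le_lt_trans bb.
by have := le_coord_norm (b - b') k; rewrite !mxE.
Qed.

End RowBlocks.

Section TangentSpaces.
Variables (R : realType) (M : atlas R) (hM : is_manifold M).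
Local Notation n := (Defs.dim M).
Local Notation A := (cinf M).
Implicit Types (p q : M) (i : chart_index M).

Lemma tangentP p (v : tangent p) : tangent_pred p v.
Proof. by case: v => v /= /asboolP. Qed.

Lemma tangent_eqP p (v w : tangent p) : (forall f, v f = w f) -> v = w.
Proof. by move=> vw; apply/val_inj/funext. Qed.

Lemma tangent_sumE p (I : Type) (r : seq I) (v : I -> tangent p) f :
  (\sum_(k <- r) v k) f = \sum_(k <- r) v k f.
Proof. by elim/big_rec2: _ => [|k y x _ <-]. Qed.

Lemma cotangentP p (xi : cotangent p) (c : R) (v w : tangent p) :
  xi (c *: v + w) = c * xi v + xi w.
Proof. by case: xi => xi /= /asboolP; apply. Qed.

Lemma cotangent_eqP p (xi eta : cotangent p) : (forall v, xi v = eta v) -> xi = eta.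
Proof. by move=> e; apply/val_inj/funext. Qed.

Lemma cotangent0 p (xi : cotangent p) : xi 0 = 0.
Proof.
by have := cotangentP xi (-1) 0 0; rewrite scaler0 addr0 mulN1r addNr.
Qed.

Lemma cotangent_sum p (xi : cotangent p) (I : Type) (r : seq I) (c : I -> R)
    (v : I -> tangent p) :
  xi (\sum_(k <- r) c k *: v k) = \sum_(k <- r) c k * xi (v k).
Proof.
elim: r => [|k r IH]; first by rewrite !big_nil cotangent0.
by rewrite !big_cons cotangentP IH.
Qed.

Lemma tangent_basis i p u (v : tangent p) : dom_of i p ->
  coordinates_near i (map_of i p) u ->
  v = \sum_j v (u j) *: coord_vector i p j.
Proof.
move=> pi up; apply: tangent_eqP => f; rewrite tangent_sumE.
have vP : tangent_pred (inv_of i (map_of i p)) v by rewrite map_ofK//; exact: tangentP.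
rewrite (pder_coord hM f (cod_map hM pi) up vP); apply: eq_bigr => j _.
transitivity (v (u j) * coord_vector i p j f); last by [].
by rewrite (coord_vectorE hM).
Qed.

Lemma coord_vector_coord i p u (j k : 'I_n) : dom_of i p ->
  coordinates_near i (map_of i p) u -> coord_vector i p j (u k) = (j == k)%:R.
Proof.
move=> pi up; rewrite (coord_vectorE hM)//.
rewrite (@near_eq_derive _ _ _ _ (fun y : 'rV[R]_n => y 0 k)).
  by rewrite derive_coord mxE eqxx eq_sym.
by apply: filterS up => x; exact.
Qed.

Lemma cotangent_coord_eq i p (xi eta : cotangent p) : dom_of i p ->
  (forall j, xi (coord_vector i p j) = eta (coord_vector i p j)) -> xi = eta.
Proof.
move=> pi e; have [u up] := coordinates_exist hM (cod_map hM pi).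
apply: cotangent_eqP => v; rewrite (tangent_basis v pi up) !cotangent_sum.
by apply: eq_bigr => j _; rewrite e.
Qed.

Lemma cotangent_coord_exists i p (y : 'rV[R]_n) : dom_of i p ->
  exists xi : cotangent p, forall j, xi (coord_vector i p j) = y 0 j.
Proof.
move=> pi; have [u up] := coordinates_exist hM (cod_map hM pi).
have lin : @cotangent_pred _ _ p (fun v : tangent p => \sum_j y 0 j * v (u j) : R^o).
  move=> c v w; rewrite [_ * (\sum_j _)]mulr_sumr -big_split.
  apply: eq_bigr => j _ /=.
  transitivity (y 0 j * (c * v (u j) + w (u j))); first by [].
  by ring.
have lin' : (fun v : tangent p => \sum_j y 0 j * v (u j) : R^o) \in @cotangent_predb _ _ p.
  exact/asboolP.
exists (Cotangent lin') => j /=.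
rewrite (bigD1 j)//= big1 => [|k kj]; rewrite (coord_vector_coord _ _ pi up).
  by rewrite eqxx mulr1 addr0.
by rewrite eq_sym (negbTE kj) mulr0.
Qed.

Definition covector_of i p (y : 'rV[R]_n) : cotangent p :=
  xget 0 [set xi : cotangent p | forall j, xi (coord_vector i p j) = y 0 j].

Lemma covector_ofE i p y j : dom_of i p ->
  covector_of i p y (coord_vector i p j) = y 0 j.
Proof.
move=> pi; have [xi xiE] := cotangent_coord_exists y pi.
by rewrite /covector_of; case: xgetP => [eta _ -> //|/(_ xi)].
Qed.

Lemma coord_vector_change i j p (k : 'I_n) : dom_of i p -> dom_of j p ->
  coord_vector j p k = \sum_l
    'D_(delta_mx 0 k) (fun y => map_of i (inv_of j y) 0 l) (map_of j p) *: coord_vector i p l.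
Proof.
move=> pi pj; have [u up] := coordinates_exist hM (cod_map hM pi).
rewrite {1}(tangent_basis (coord_vector j p k) pi up); apply: eq_bigr => l _.
congr (_ *: _); rewrite (coord_vectorE hM)//; apply: near_eq_derive.
have pi' : dom_of i (inv_of j (map_of j p)) by rewrite map_ofK.
have cc := smooth_vec_at_continuous (smooth_transition hM (cod_map hM pj) pi').
have nu : \forall y \near map_of j p,
    forall m : 'I_n, u m (inv_of i (map_of i (inv_of j y))) = map_of i (inv_of j y) 0 m.
  have {}up : coordinates_near i ((map_of i \o inv_of j) (map_of j p)) u.
    by rewrite /= map_ofK.
  exact: cc _ up.
have nd := near_dom hM (cod_map hM pj) pi'.
near=> y; have yi : dom_of i (inv_of j y) by near: y.
rewrite /= -[inv_of j y in LHS](map_ofK hM yi).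
by move: l; near: y.
Unshelve. all: by end_near. Qed.

End TangentSpaces.

Section CotangentManifold.
Variables (R : realType) (M : atlas R) (hM : is_manifold M).
Local Notation n := (Defs.dim M).
Local Notation N := (cotangent_bundle M).
Implicit Types (p : M) (i : chart_index M) (z : N).

(** The base point recovered from its coordinates is only propositionally equal to
    the original one, so the equality of covectors lives in the total space. *)
Lemma existT_covector i p (q : M) (xi : cotangent q) (y : 'rV[R]_n) : p = q -> dom_of i q ->
  (forall j, xi (coord_vector i q j) = y 0 j) ->
  existT (@cotangent _ M) p (covector_of i p y) = existT _ q xi.
Proof.
move=> -> qi xiE; congr existT; apply: (cotangent_coord_eq hM qi) => j.
by rewrite (covector_ofE hM)// xiE.
Qed.

Lemma cotangent_is_chart i : is_chart (cotangent_chart i).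
Proof.
have [oc mP iP mK iK] := manifold_chart hM i; split.
- rewrite /=; have := oc; rewrite -[chart_cod _]/(cod_of i) => {}oc.
  have := @continuous_lsubmx R 1 n n; move/continuousP => /(_ _ oc).
  by [].
- by move=> [p xi] /= pi; rewrite row_mxKl; exact: mP.
- by move=> x /= xi; exact: iP.
- move=> [p xi] /= pi; apply: existT_covector => //.
    by rewrite row_mxKl; exact: mK.
  by move=> j; rewrite row_mxKr mxE.
- move=> x /= xi; rewrite -[RHS]hsubmxK /map_of iK//; congr row_mx.
  apply/rowP => j; rewrite mxE.
  by apply: (covector_ofE hM); exact: iP.
Qed.

(** The fibre coordinates change linearly, by the Jacobian matrix of the change of
    charts of the base, whose entries are smooth. *)
Lemma cotangent_transition i (j : chart_index M) (x : 'rV[R]_(n + n)) :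
  cod_of i (lsubmx x) -> dom_of j (inv_of i (lsubmx x)) ->
  smooth_vec_at (chart_map (cotangent_chart j) \o chart_inv (cotangent_chart i)) x.
Proof.
move=> xi xj.
have cl : {for x, continuous (lsubmx : 'rV[R]_(n + n) -> 'rV[R]_n)}.
  exact: (smooth_vec_at_continuous (@smooth_lsubmx R n n x)).
have ni := cl _ (near_cod hM xi); have nj := cl _ (near_dom hM xi xj).
have st := smooth_transition hM xi xj.
move=> k; rewrite -(splitK k); case: (fintype.split k) => a /=.
  have base : smooth_at ((fun y : 'rV[R]_n => map_of j (inv_of i y) 0 a) \o
      (lsubmx : 'rV[R]_(n + n) -> 'rV[R]_n)) x.
    by apply: smooth_at_comp; [exact: smooth_lsubmx|exact: st].
  apply: smooth_at_ext base.
  by near=> y; rewrite row_mxEl.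
pose g l := 'D_(delta_mx 0 a) (fun y : 'rV[R]_n => map_of i (inv_of j y) 0 l) \o
  ((map_of j \o inv_of i) \o (lsubmx : 'rV[R]_(n + n) -> 'rV[R]_n)).
apply: (@smooth_at_ext _ _ (\sum_l (g l * (fun y : 'rV[R]_(n + n) => rsubmx y 0 l)))).
  near=> y; have yi : cod_of i (lsubmx y) by near: y; exact: ni.
  have yj : dom_of j (inv_of i (lsubmx y)) by near: y; exact: nj.
  have yi' := dom_inv hM yi.
  rewrite row_mxEr mxE /= (coord_vector_change hM _ yi' yj) cotangent_sum fct_sumE.
  by apply: eq_bigr => l _; rewrite (covector_ofE hM).
apply: smooth_at_sum => l; apply: smooth_atM; last exact: smooth_rsubmx.
apply: smooth_at_comp => [b|].
  apply: (smooth_at_comp (f := fun y : 'rV[R]_n => (map_of j \o inv_of i) y 0 b)).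
    exact: smooth_lsubmx.
  exact: st.
apply: smooth_at_derive.
apply: (@smooth_transition _ _ hM j i); first exact: cod_map.
by rewrite map_ofK//; exact: dom_inv.
Unshelve. all: by end_near. Qed.

Lemma cotangent_smooth_transitions : smooth_map (@id N).
Proof.
move=> i j x xi xj; split; last exact: cotangent_transition.
have cl : {for x, continuous (lsubmx : 'rV[R]_(n + n) -> 'rV[R]_n)}.
  exact: (smooth_vec_at_continuous (@smooth_lsubmx R n n x)).
exact: cl _ (@near_dom _ _ hM i j (lsubmx x) xi xj).
Qed.

Lemma cotangent_open_chart (i : chart_index M) (W : set 'rV[R]_(n + n)) : open W ->
  atlas_open (M := N) [set z | dom_of i (projT1 z) /\ W (chart_map (cotangent_chart i) z)].
Proof.
move=> oW; have := @atlas_open_chart R N cotangent_is_chart cotangent_smooth_transitions i W oW.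
exact.
Qed.

Lemma base_open_chart (i : chart_index M) (W : set 'rV[R]_n) : open W ->
  atlas_open [set p | dom_of i p /\ W (map_of i p)].
Proof. exact: (atlas_open_chart (manifold_chart hM) (manifold_smooth hM)). Qed.

Lemma cotangent_proj_open (U : set M) : atlas_open U ->
  atlas_open (M := N) (@cotangent_proj R M @^-1` U).
Proof.
move=> oU i; have := @continuous_lsubmx R 1 n n.
by move/continuousP => /(_ _ (oU i)).
Qed.

(** Points over different base points are separated by preimages of open sets of
    the base; points over the same base point lie in a common chart. *)
Lemma cotangent_hausdorff (z w : N) : z <> w ->
  exists U V : set N, [/\ atlas_open U, atlas_open V, U z, V w & U `&` V = set0].
Proof.
move=> zw; have [pzw|pzw] := pselect (cotangent_proj z = cotangent_proj w); last first.
  have [U [V [oU oV Uz Vw UV]]] := manifold_hausdorff hM pzw.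
  exists (@cotangent_proj R M @^-1` U), (@cotangent_proj R M @^-1` V); split=> //.
  - exact: cotangent_proj_open.
  - exact: cotangent_proj_open.
  - by rewrite -preimage_setI UV preimage_set0.
have [i zi] := manifold_cover hM (cotangent_proj z).
have wi : dom_of i (cotangent_proj w) by rewrite -pzw.
pose x := chart_map (cotangent_chart i).
have [_ _ _ mK _] := cotangent_is_chart i.
have xzw : x z != x w.
  by apply/eqP => e; apply: zw; rewrite -(mK z zi) -(mK w wi); congr chart_inv.
have := @norm_hausdorff R 'rV[R]_(n + n); rewrite open_hausdorff => /(_ _ _ xzw).
move=> [[A B] /= [/set_mem Az /set_mem Bw] [oA oB /eqP AB]].
exists [set v | dom_of i (projT1 v) /\ A (x v)], [set v | dom_of i (projT1 v) /\ B (x v)].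
split=> //; try exact: cotangent_open_chart.
apply/seteqP; split=> v //= [[_ Av] [_ Bv]].
by have : (A `&` B) (x v) by []; rewrite AB.
Qed.

Lemma rational_approx (y : 'rV[R]_n) (e : R) : 0 < e ->
  exists q : 'rV[rat]_n, ball (map_mx ratr q : 'rV[R]_n) e y.
Proof.
move=> e0; have ex (j : 'I_n) : exists r : rat, `|ratr r - y 0 j| < e.
  have [|r] := @rat_in_itvoo R (y 0 j - e) (y 0 j + e).
    by rewrite ltrBlDr -addrA ltrDl addr_gt0.
  rewrite in_itv /= => /andP[h1 h2]; exists r.
  by rewrite ltr_norml ltrBlDl h2 andbT ltrBrDl.
have [q qP] := choice ex; exists (\row_j q j).
by rewrite -ball_normE /=; apply: row_norm_lt => // j; rewrite !mxE; exact: qP.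
Qed.

(** A countable basis of the base selects countably many charts. In each of them
    the sets that are basic in the base direction and rational balls in the fibre
    direction form a basis. *)
Lemma cotangent_second_countable : exists B : nat -> set N,
    (forall k, atlas_open (B k)) /\
    (forall (W : set N) (z : N), atlas_open W -> W z -> exists k, B k z /\ B k `<=` W).
Proof.
have [B [oB basisB]] := manifold_second_countable hM.
have chartB k : exists c : option (chart_index M), forall i : chart_index M,
    B k `<=` dom_of i -> if c is Some j then B k `<=` dom_of j else False.
  have [[i iB]|nB] := pselect (exists i : chart_index M, B k `<=` dom_of i).
    by exists (Some i).
  by exists None => i iB; apply: nB; exists i.
(* c k is a chart containing B k, if there is one *)
have [c cP] := choice chartB.
pose fiber k (q : 'rV[rat]_n) (m : nat) : set N := fun z =>
  if c k is Some i then B k `<=` dom_of i /\ B k (projT1 z) /\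
     ball (map_mx ratr q : 'rV[R]_n) m.+1%:R^-1 (rsubmx (chart_map (cotangent_chart i) z))
  else False.
have ofiber k q m : atlas_open (fiber k q m).
  have o0 : atlas_open (set0 : set N) by move=> i; rewrite preimage_set0 setI0; exact: open0.
  rewrite /fiber; case: (c k) => [i|]; last exact: o0.
  have [iB|niB] := pselect (B k `<=` dom_of i); last first.
    by rewrite (_ : (fun z => _) = set0)//; apply/seteqP; split=> z //= [/niB].
  pose W : set 'rV[R]_(n + n) := (rsubmx : _ -> 'rV[R]_n) @^-1`
    ball (map_mx ratr q : 'rV[R]_n) m.+1%:R^-1.
  have oW : open W.
    have := @continuous_rsubmx R 1 n n; move/continuousP; apply.
    exact: ball_open.
  rewrite (_ : (fun z => _) = @cotangent_proj R M @^-1` B k `&`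
      [set z | dom_of i (projT1 z) /\ W (chart_map (cotangent_chart i) z)]).
    by apply: (@atlas_openI _ N); [exact: cotangent_proj_open|exact: cotangent_open_chart].
  apply/seteqP; split=> z /=.
    by move=> [_ [Bz bz]]; split=> //; split=> //; exact: iB.
  by move=> [Bz [_ bz]]; split.
pose base (s : nat * nat * 'rV[rat]_n * nat) : set N :=
  fiber s.1.1.1 s.1.2 s.2 `&` @cotangent_proj R M @^-1` B s.1.1.2.
exists (fun k => if unpickle k is Some s then base s else set0); split.
  move=> k; case: unpickle => [s|]; last first.
    by move=> i; rewrite preimage_set0 setI0; exact: open0.
  by apply: (@atlas_openI _ N); [exact: ofiber|exact: cotangent_proj_open].
move=> W z oW Wz; have [i0 zi0] := manifold_cover hM (projT1 z).
have odom : atlas_open (dom_of i0).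
  have oT : open (setT : set 'rV[R]_n) by exact: openT.
  have := @base_open_chart i0 _ oT.
  by rewrite (_ : [set p | _] = dom_of i0)//; apply/seteqP; split=> p //= [].
have [k [Bkz Bk0]] := basisB _ _ odom zi0.
have := cP k i0 Bk0; case ck : (c k) => [i|//] iB.
have zi : dom_of i (projT1 z) by exact: iB.
have [oc mP iP mK iK] := cotangent_is_chart i.
pose x := chart_map (cotangent_chart i) z.
have Wx : W (chart_inv (cotangent_chart i) x) by rewrite /x mK.
have : nbhs x (chart_cod (cotangent_chart i) `&` chart_inv (cotangent_chart i) @^-1` W).
  apply: open_nbhs_nbhs; split; first exact: oW i.
  by split; [exact: mP|exact: Wx].
move=> /nbhs_ballP[e /= e0 xe].
have ob : open (ball (lsubmx x : 'rV[R]_n) e) by exact: ball_open.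
have oU := @base_open_chart i _ ob.
have Uz : [set p | dom_of i p /\ ball (lsubmx x) e (map_of i p)] (projT1 z).
  by split=> //; rewrite row_mxKl; exact: ballxx.
have [k' [Bk'z Bk'U]] := basisB _ _ oU Uz.
have [m me] : exists m : nat, m.+1%:R^-1 < e / 2.
  have [m] := ltr_add_invr (divr_gt0 e0 (ltr0Sn R 1)); rewrite add0r => me; by exists m.
have m0 : 0 < m.+1%:R^-1 :> R by rewrite invr_gt0 ltr0n.
have [q qx] := rational_approx (rsubmx x) m0.
exists (pickle (k, k', q, m)); rewrite pickleK; split.
  by split=> //=; rewrite /fiber ck; split.
move=> w [/= + Bw]; rewrite /fiber ck => -[_ [Bkw qw]].
have wi : dom_of i (projT1 w) by exact: iB.
rewrite -(mK w wi).
suff /xe[] : ball x e (chart_map (cotangent_chart i) w) by [].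
rewrite -[x]hsubmxK -[X in ball _ _ X]hsubmxK; apply: ball_row_mx => //.
  by have [_] := Bk'U _ Bw; rewrite [X in ball _ _ X -> _](_ : _ = lsubmx (chart_map (cotangent_chart i) w)) // row_mxKl.
apply: (@ball_splitr _ _ (map_mx ratr q : 'rV[R]_n)); apply: le_ball (ltW me) _ _.
  exact: qx.
exact: qw.
Qed.

Theorem cotangent_bundle_is_manifold : is_manifold N.
Proof.
split.
- exact: cotangent_is_chart.
- by move=> z; have [i] := manifold_cover hM (projT1 z); exists i.
- exact: cotangent_smooth_transitions.
- exact: cotangent_hausdorff.
- exact: cotangent_second_countable.
Qed.

End CotangentManifold.

(** * Horizontal lifts *)

Section CotangentFunctions.
Variables (R : realType) (M : atlas R) (hM : is_manifold M).
Local Notation n := (Defs.dim M).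
Local Notation N := (cotangent_bundle M).
Local Notation A := (cinf M).
Local Notation pr := (@cotangent_proj R M).
Implicit Types (p : M) (i : chart_index M) (z : N) (f : A) (X Y Z : vfield M).
Implicit Types (alpha beta : one_form M) (F : cinf N).

Let hN : is_manifold N := cotangent_bundle_is_manifold hM.

Lemma near_lsubmx (x : 'rV[R]_(n + n)) (P : 'rV[R]_n -> Prop) :
  (\forall y \near lsubmx x, P y) -> \forall y \near x, P (lsubmx y).
Proof.
move=> Px; exact: (smooth_vec_at_continuous (@smooth_lsubmx R n n x)) Px.
Qed.

Lemma cotangent_proj_smooth : smooth_map pr.
Proof.
move=> i j x xi xj.
have {}xj : dom_of j (inv_of (i : chart_index M) (lsubmx x)) by exact: xj.
have {}xi : cod_of (i : chart_index M) (lsubmx x) by exact: xi.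
split; first exact: near_lsubmx (near_dom hM xi xj).
move=> k; apply: (@smooth_at_comp _ _ _ (fun y => (map_of j \o inv_of (i : chart_index M)) y 0 k)).
  exact: smooth_lsubmx.
exact: smooth_transition.
Qed.

Lemma pullback_proj_smooth f : smooth_fun (f \o pr).
Proof.
move=> i x xi.
apply: (@smooth_at_comp _ _ _ (f \o inv_of (i : chart_index M))).
  exact: smooth_lsubmx.
exact: (cinfP f xi).
Qed.

Lemma pullback_projE f z : pullback pr f z = f (pr z).
Proof. by rewrite /pullback to_cinfE//; exact: pullback_proj_smooth. Qed.

Lemma cotangent_chart_inv i (x : 'rV[R]_(n + n)) :
  @inv_of R N i x = existT _ (inv_of i (lsubmx x))
    (covector_of i (inv_of i (lsubmx x)) (rsubmx x)).
Proof. by []. Qed.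

Lemma vfield_at_basis i y u X : cod_of i y -> coordinates_near i y u ->
  vfield_at X (inv_of i y) = \sum_j X (u j) (inv_of i y) *: coord_vector i (inv_of i y) j.
Proof.
move=> yi uy; apply: (tangent_basis hM); first exact: dom_inv.
by rewrite inv_ofK.
Qed.

(** The function that a vector field defines on covectors; together with the
    functions of the base these separate the derivations of the total space. *)
Definition momentum Y : cinf N := to_cinf (fun z : N => projT2 z (vfield_at Y (projT1 z))).

Lemma momentum_smooth Y : smooth_fun (fun z : N => projT2 z (vfield_at Y (projT1 z))).
Proof.
move=> i x xi; have {}xi : cod_of (i : chart_index M) (lsubmx x) by exact: xi.
have [u ux] := coordinates_exist hM xi.
have nx : \forall y \near x, cod_of (i : chart_index M) (lsubmx y) /\
    coordinates_near (i : chart_index M) (lsubmx y) u.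
  apply: (@near_lsubmx x (fun y => cod_of (i : chart_index M) y /\
    coordinates_near (i : chart_index M) y u)).
  have nc := near_cod hM xi; have nu := near_join ux.
  by near=> y; split; near: y.
apply: (@smooth_at_ext _ _ (\sum_j ((Y (u j) \o inv_of (i : chart_index M)) \o
    (lsubmx : 'rV[R]_(n + n) -> 'rV[R]_n)) * (fun y : 'rV[R]_(n + n) => rsubmx y 0 j))).
  apply: filterS nx => y [yi uy].
  rewrite [RHS]/= -[RHS]/(covector_of (i : chart_index M) _ _ (vfield_at Y _)).
  rewrite (vfield_at_basis Y yi uy) cotangent_sum fct_sumE.
  apply: eq_bigr => j _; rewrite (covector_ofE hM)//; exact: dom_inv.
apply: smooth_at_sum => j; apply: smooth_atM; last exact: smooth_rsubmx.
apply: smooth_at_comp; first exact: smooth_lsubmx.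
exact: (cinfP (Y (u j)) xi).
Unshelve. all: by end_near. Qed.

Lemma momentumE Y z : momentum Y z = projT2 z (vfield_at Y (projT1 z)).
Proof. by rewrite /momentum to_cinfE//; exact: momentum_smooth. Qed.

Lemma momentum_lin f X Y :
  momentum (f *: X + Y) = pullback pr f * momentum X + momentum Y.
Proof.
apply: cinf_eqP => z.
transitivity (pullback pr f z * momentum X z + momentum Y z); last by [].
rewrite !momentumE pullback_projE -cotangentP; congr (projT2 z _).
exact: tangent_eqP.
Qed.

Lemma vfield_at_surj p (v : tangent p) : exists X, vfield_at X p = v.
Proof.
have [i pi] := manifold_cover hM p; have ai := cod_map hM pi.
have [u up] := coordinates_exist hM ai; have [E EP] := frame_exists hM ai.
exists (\sum_j cinf_cst M (v (u j)) *: E j); apply: tangent_eqP => f.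
rewrite [in RHS](tangent_basis hM v pi up) tangent_sumE.
transitivity ((\sum_j cinf_cst M (v (u j)) *: E j) f p); first by [].
rewrite vfield_sumE cinf_sumE; apply: eq_bigr => j _.
transitivity (v (u j) * E j f p); first by [].
transitivity (v (u j) * coord_vector i p j f); last by [].
by rewrite (coord_vectorE hM)// -(nbhs_singleton EP) map_ofK.
Qed.

Lemma cotangent_field_eq p (xi eta : cotangent p) :
  (forall X, xi (vfield_at X p) = eta (vfield_at X p)) -> xi = eta.
Proof.
move=> e; apply: cotangent_eqP => v; have [X <-] := vfield_at_surj v; exact: e.
Qed.

(** The covector is built from the local generators: its value on a tangent vector
    [v] is the sum of the [alpha (E j)] weighted by [v (u j)]. *)
Lemma form_atE alpha p X : form_at alpha p (vfield_at X p) = alpha X p.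
Proof.
have [chi [u [E [chi1 chiE]]]] := local_generators hM p.
have lin : @cotangent_pred _ _ p (fun v : tangent p => \sum_j alpha (E j) p * v (u j) : R^o).
  move=> c v w; rewrite [_ * (\sum_j _)]mulr_sumr -big_split.
  apply: eq_bigr => j _ /=.
  transitivity (alpha (E j) p * (c * v (u j) + w (u j))); first by [].
  by ring.
have lin' : (fun v : tangent p => \sum_j alpha (E j) p * v (u j) : R^o) \in @cotangent_predb _ _ p.
  exact/asboolP.
have xiP Y : Cotangent lin' (vfield_at Y p) = alpha Y p.
  rewrite -[RHS]mul1r -chi1 -[RHS]cinfM -form_scale chiE form_sum cinf_sumE /=.
  by apply: eq_bigr => j _; rewrite form_scale cinfM mulrC.
by rewrite /form_at; case: xgetP => [eta _ ->//|/(_ (Cotangent lin'))].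
Qed.

Lemma form_at_eq alpha p (xi : cotangent p) :
  (forall X, alpha X p = xi (vfield_at X p)) -> form_at alpha p = xi.
Proof. by move=> e; apply: cotangent_field_eq => X; rewrite form_atE e. Qed.

Lemma form_through p (xi : cotangent p) : exists alpha, form_at alpha p = xi.
Proof.
have [chi [u [E [chi1 chiE]]]] := local_generators hM p.
exists (\sum_j cinf_cst M (xi (vfield_at (E j) p)) *: dform (u j)).
apply: form_at_eq => X; rewrite form_sumE cinf_sumE.
have -> : vfield_at X p = \sum_j X (u j) p *: vfield_at (E j) p.
  apply: tangent_eqP => f; rewrite tangent_sumE.
  have := congr1 (fun Y : vfield M => Y f p) (chiE X).
  rewrite vfield_sumE cinf_sumE => e.
  transitivity (chi p * X f p); first by rewrite chi1 mul1r.
  exact: e.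
rewrite cotangent_sum; apply: eq_bigr => j _.
transitivity (xi (vfield_at (E j) p) * X (u j) p); first by [].
by rewrite mulrC.
Qed.

(** In charts a section is [y |-> (y, coefficients of alpha at y)], and these
    coefficients are the values of [alpha] on a local frame. *)
Lemma section_smooth alpha F : smooth_fun (F \o form_section alpha).
Proof.
move=> i x xi; have [E EP] := frame_exists hM xi.
pose g (y : 'rV[R]_n) : 'rV[R]_(n + n) := row_mx y (\row_j alpha (E j) (inv_of i y)).
have gx : @cod_of R N i (g x) by rewrite /cod_of /= /g row_mxKl.
apply: (@smooth_at_ext _ _ ((F \o @inv_of R N i) \o g)); last first.
  apply: smooth_at_comp; last exact: (cinfP F gx).
  move=> k; rewrite -(splitK k); case: (fintype.split k) => j /=.
    by apply: smooth_at_ext (smooth_at_coord j x); near=> y; rewrite /g row_mxEl.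
  apply: smooth_at_ext (cinfP (alpha (E j)) xi); near=> y.
  by rewrite /g row_mxEr mxE.
near=> y; have yi : cod_of i y by near: y; exact: near_cod.
have Ey : forall (j : 'I_n) (f : A), E j f (inv_of i y) = 'D_(delta_mx 0 j) (f \o inv_of i) y.
  by near: y; exact: EP.
have yi' := dom_inv hM yi.
rewrite /=; congr (F _); rewrite -[LHS]/(@inv_of R N i (g y)) cotangent_chart_inv.
apply: (existT_covector hM) => //; first by rewrite /g row_mxKl.
move=> j; rewrite /g row_mxKr mxE -form_atE; congr (form_at _ _ _).
by apply: tangent_eqP => f; rewrite (coord_vectorE hM)// inv_ofK// -Ey.
Unshelve. all: by end_near. Qed.

Lemma pullback_sectionE alpha F p : pullback (form_section alpha) F p = F (form_section alpha p).
Proof. by rewrite /pullback to_cinfE//; exact: section_smooth. Qed.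

Lemma pullback_section_proj alpha f : pullback (form_section alpha) (pullback pr f) = f.
Proof. by apply: cinf_eqP => p; rewrite pullback_sectionE pullback_projE. Qed.

Lemma pullback_section_momentum alpha Y :
  pullback (form_section alpha) (momentum Y) = alpha Y.
Proof. by apply: cinf_eqP => p; rewrite pullback_sectionE momentumE /= form_atE. Qed.

Lemma section_tangent_pred alpha X p :
  tangent_pred (form_section alpha p)
    (fun F => X (pullback (form_section alpha) F) p : R^o).
Proof.
split=> [c F G|F G].
  have -> : pullback (form_section alpha) (cinf_cst N c * F + G)
      = cinf_cst M c * pullback (form_section alpha) F + pullback (form_section alpha) G.
    apply: cinf_eqP => q.
    transitivity (c * pullback (form_section alpha) F q + pullback (form_section alpha) G q);
      last by [].
    by rewrite !pullback_sectionE.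
  by have [-> _] := vfieldP X.
have -> : pullback (form_section alpha) (F * G)
    = pullback (form_section alpha) F * pullback (form_section alpha) G.
  apply: cinf_eqP => q.
  transitivity (pullback (form_section alpha) F q * pullback (form_section alpha) G q);
    last by [].
  by rewrite !pullback_sectionE.
rewrite vfieldM -!pullback_sectionE.
by [].
Qed.

(** Near a point these are the coordinates of the cotangent chart, when [u] and
    [E] are the coordinates and the coordinate frame of the chart of the base. *)
Definition bundle_coordinates (u : 'I_n -> A) (E : 'I_n -> vfield M) (k : 'I_(n + n)) :
    cinf N :=
  match fintype.split k with
  | inl j => pullback pr (u j)
  | inr j => momentum (E j)
  end.

Lemma bundle_coordinates_near i (x : 'rV[R]_(n + n)) u E : cod_of i (lsubmx x) ->
  coordinates_near i (lsubmx x) u -> frame_near i (lsubmx x) E ->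
  @coordinates_near R N i x (bundle_coordinates u E).
Proof.
move=> xi ux Ex.
have nx : \forall y \near x, [/\ cod_of i (lsubmx y),
    forall j : 'I_n, u j (inv_of i (lsubmx y)) = lsubmx y 0 j
  & forall (j : 'I_n) (f : A), E j f (inv_of i (lsubmx y))
     = 'D_(delta_mx 0 j) (f \o inv_of i) (lsubmx y)].
  apply: (@near_lsubmx x (fun y => [/\ cod_of i y, forall j : 'I_n, u j (inv_of i y) = y 0 j
    & forall (j : 'I_n) (f : A), E j f (inv_of i y)
     = 'D_(delta_mx 0 j) (f \o inv_of i) y])).
  have nc := near_cod hM xi.
  by near=> y; split; [near: y|near: y|near: y].
apply: filterS nx => y [yi uy Ey] k; rewrite /bundle_coordinates.
rewrite -[in RHS](splitK k); case: (fintype.split k) => j /=.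
  by rewrite pullback_projE /= uy mxE.
rewrite momentumE /=.
have -> : vfield_at (E j) (inv_of i (lsubmx y)) = coord_vector i (inv_of i (lsubmx y)) j.
  apply: tangent_eqP => f.
  by rewrite (coord_vectorE hM) ?inv_ofK//; [exact: Ey|exact: dom_inv].
by rewrite -[LHS]/(covector_of i _ _ _) (covector_ofE hM) ?mxE//; exact: dom_inv.
Unshelve. all: by end_near. Qed.

Lemma bundle_chart_frame z : exists i u E,
  [/\ dom_of i (pr z), @coordinates_near R N i (@map_of R N i z) (bundle_coordinates u E)
    & cod_of i (lsubmx (@map_of R N i z))].
Proof.
have [i zi] := manifold_cover hM (pr z).
have ci : cod_of i (lsubmx (@map_of R N i z)) by rewrite row_mxKl; exact: cod_map.
have [u ux] := coordinates_exist hM ci; have [E Ex] := frame_exists hM ci.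
by exists i, u, E; split=> //; exact: bundle_coordinates_near.
Qed.

(** Functions pulled back from the base and momenta of vector fields provide
    coordinates on the cotangent bundle, hence detect derivations. *)
Lemma bundle_pder_eq z (v w : cinf N -> R^o) : tangent_pred z v -> tangent_pred z w ->
  (forall f, v (pullback pr f) = w (pullback pr f)) ->
  (forall Y, v (momentum Y) = w (momentum Y)) -> forall F, v F = w F.
Proof.
move=> vP wP e1 e2 F; have [i [u [E [zi cz _]]]] := bundle_chart_frame z.
have zi' : @dom_of R N i z by exact: zi.
have vP' : tangent_pred (@inv_of R N i (@map_of R N i z)) v by rewrite (map_ofK hN).
have wP' : tangent_pred (@inv_of R N i (@map_of R N i z)) w by rewrite (map_ofK hN).
rewrite (pder_coord hN F (cod_map hN zi') cz vP') (pder_coord hN F (cod_map hN zi') cz wP').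
apply: eq_bigr => k _; congr (_ * _); rewrite /bundle_coordinates.
by case: (fintype.split k) => j; rewrite ?e1 ?e2.
Qed.

Lemma bundle_vfield_eq (V W : vfield N) :
  (forall f, V (pullback pr f) = W (pullback pr f)) ->
  (forall Y, V (momentum Y) = W (momentum Y)) -> V = W.
Proof.
move=> e1 e2; apply: vfield_eqP => F; apply: cinf_eqP => z.
apply: (bundle_pder_eq (vfield_at_pred V z) (vfield_at_pred W z)) => [f|Y].
  by rewrite e1.
by rewrite e2.
Qed.

Section HorizontalLift.
Variable D : connection M.

Lemma dual_nablaE Z alpha Y : dual_nabla D Z alpha Y = Z (alpha Y) - alpha (D Z Y).
Proof. by []. Qed.

(** [D Z Y] is [C^oo(M)]-linear in [Z], so [linear_vanishing_at] applies to
    [Z - Z']. *)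
Lemma connection_tensorial alpha Z Z' Y p : (forall f, Z f p = Z' f p) ->
  alpha (D Z Y) p = alpha (D Z' Y) p.
Proof.
move=> ZZ'; pose T X := alpha (D X Y).
have lT f X X' : T (f *: X + X') = f * T X + T X' by rewrite /T nabla_linl formP.
have Z0 f : (Z - Z') f p = 0.
  by transitivity (Z f p - Z' f p); [|rewrite ZZ' subrr].
have := linear_vanishing_at hM lT Z0.
have -> : Z - Z' = -1 *: Z' + Z by rewrite scaleN1r addrC.
rewrite lT mulN1r /T => e.
have {}e : - alpha (D Z' Y) p + alpha (D Z Y) p = 0 by exact: e.
by apply/eqP; rewrite -subr_eq0 addrC e.
Qed.

(** A form through [z] is corrected by subtracting [h] times its own derivative
    along [Z], where [h] vanishes at the base point and has derivative 1 along
    [Z] there. Such an [h] exists unless [Z] vanishes at the base point, in which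
    case the derivative along [Z] already does. *)
Lemma parallel_form_through Z z : exists alpha, form_section alpha (pr z) = z /\
  forall Y, dual_nabla D Z alpha Y (pr z) = 0.
Proof.
case: z => p xi; rewrite -[pr _]/p; have [alpha alphap] := form_through xi.
have [Z0|/existsNP[f Zf]] := pselect (forall f, Z f p = 0).
  exists alpha; split; first by rewrite /form_section alphap.
  move=> Y; rewrite dual_nablaE cinfB Z0 sub0r; apply/eqP; rewrite oppr_eq0; apply/eqP.
  rewrite (@connection_tensorial alpha Z 0) => [|g]; last by rewrite Z0.
  have -> : D 0 Y = 0.
    by have := nabla_linl D (-1) 0 0 Y; rewrite scaler0 addr0 scaleN1r addNr.
  by rewrite form_zero.
pose h : A := cinf_cst M (Z f p)^-1 * (f - cinf_cst M (f p)).
have hp : h p = 0.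
  by transitivity ((Z f p)^-1 * (f p - f p)); [|rewrite subrr mulr0].
have Zh : Z h p = 1.
  rewrite /h vfieldM vfield_cst mulr0 addr0 vfieldB vfield_cst subr0.
  transitivity ((Z f p)^-1 * Z f p); first by [].
  by rewrite mulVf//; apply/eqP.
pose beta := dual_nabla D Z alpha.
exists (- h *: beta + alpha); split.
  rewrite /form_section; congr existT; rewrite -alphap; apply: form_at_eq => X.
  transitivity (- h p * beta X p + alpha X p); first by [].
  by rewrite hp oppr0 mul0r add0r form_atE.
move=> Y; rewrite dual_nablaE.
transitivity ((Z (- h * beta Y + alpha Y) - (- h * beta (D Z Y) + alpha (D Z Y))) p);
  first by [].
rewrite vfieldD vfieldM vfieldN.
transitivity (- h p * Z (beta Y) p + beta Y p * - Z h p + Z (alpha Y) p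
  - (- h p * beta (D Z Y) p + alpha (D Z Y) p)); first by [].
rewrite hp Zh; transitivity (- beta Y p + (Z (alpha Y) p - alpha (D Z Y) p)).
  by ring.
transitivity (- beta Y p + beta Y p); first by [].
by rewrite addNr.
Qed.

(** For a form parallel along [Z] at the base point, differentiating its value on
    [Y] only differentiates [Y]. *)
Lemma horizontal_momentum Z z alpha Y :
  form_section alpha (pr z) = z ->
  (forall X, dual_nabla D Z alpha X (pr z) = 0) ->
  Z (alpha Y) (pr z) = momentum (D Z Y) z.
Proof.
move=> az dz; have := dz Y; rewrite dual_nablaE cinfB => /eqP.
rewrite subr_eq0 => /eqP ->.
by rewrite -[in RHS]az -pullback_sectionE pullback_section_momentum.
Qed.

(** At each point the lift is the derivation along a parallel form. Its values on
    the bundle coordinates are again smooth functions on the bundle, so the lift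
    is smooth in every chart by [pder_coord]. *)
Lemma hlift_exists Z : exists W : vfield N, forall z,
  horizontal D z (fun F => W F z) /\ forall f, W (pullback pr f) z = Z f (pr z).
Proof.
have [s sP] := choice (parallel_form_through Z).
pose v (F : cinf N) : N -> R := fun z => Z (pullback (form_section (s z)) F) (pr z).
have vP z : tangent_pred z (v^~ z : cinf N -> R^o).
  by have := section_tangent_pred (s z) Z (pr z); rewrite (sP z).1.
have vpr f z : v (pullback pr f) z = Z f (pr z).
  by rewrite /v pullback_section_proj.
have vmom Y z : v (momentum Y) z = momentum (D Z Y) z.
  by rewrite /v pullback_section_momentum; have [sz dz] := sP z; exact: horizontal_momentum.
have sv F : smooth_fun (v F).
  move=> i x xi; have {}xi : cod_of (i : chart_index M) (lsubmx x) by exact: xi.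
  have [u ux] := coordinates_exist hM xi; have [E Ex] := frame_exists hM xi.
  have wx := bundle_coordinates_near xi ux Ex.
  pose w (k : 'I_(n + n)) : cinf N := match fintype.split k with
    | inl j => pullback pr (Z (u j)) | inr j => momentum (D Z (E j)) end.
  apply: (@smooth_at_ext _ _ (\sum_(k < n + n) ((w k \o @inv_of R N i) *
      'D_(delta_mx 0 k) (F \o @inv_of R N i)))); last first.
    apply: smooth_at_sum => k; apply: smooth_atM; first exact: (cinfP (w k) xi).
    by apply: smooth_at_derive; exact: (cinfP F xi).
  have nc : \forall y \near x, @cod_of R N i y by exact: (near_cod hN xi).
  have nw := near_join wx.
  near=> y; have yi : @cod_of R N i y by near: y.
  have wy : @coordinates_near R N i y (bundle_coordinates u E) by near: y.
  rewrite fct_sumE [RHS]/= (pder_coord hN F yi wy (vP _)); apply: eq_bigr => k _.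
  congr (_ * _); rewrite /w /bundle_coordinates.
  by case: (fintype.split k) => j; rewrite ?vpr ?vmom /= ?pullback_projE.
have vE F z : to_cinf (v F) z = v F z by rewrite (to_cinfE (sv F)).
have dv : derivation (fun F : cinf N => to_cinf (v F) : (cinf N)^o).
  split=> [c F G|F G]; apply: cinf_eqP => z.
    transitivity (c * v F z + v G z); last by rewrite -!vE.
    by rewrite vE; have [-> _] := vP z.
  transitivity (F z * v G z + G z * v F z); last by rewrite -!vE.
  by rewrite vE; have [_ ->] := vP z.
have dv' : (fun F : cinf N => to_cinf (v F) : (cinf N)^o) \in @derivationb R N.
  exact/asboolP.
exists (VField dv') => z; split; last by move=> f; rewrite /= vE vpr.
exists Z, (s z); have [sz dz] := sP z; split=> // F.
by rewrite /= vE.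
Unshelve. all: by end_near. Qed.

Lemma hliftP Z z : horizontal D z (fun F => hlift D Z F z) /\
  forall f, hlift D Z (pullback pr f) z = Z f (pr z).
Proof.
have [W WP] := hlift_exists Z; rewrite /hlift.
by case: xgetP => [V _ /(_ z)//|/(_ W)/(_ WP)].
Qed.

Lemma hlift_pullback Z f : hlift D Z (pullback pr f) = pullback pr (Z f).
Proof.
by apply: cinf_eqP => z; rewrite pullback_projE; have [_ ->] := hliftP Z z.
Qed.

(** With [hlift_pullback], this determines the lift by [bundle_vfield_eq]. *)
Lemma hlift_momentum Z Y : hlift D Z (momentum Y) = momentum (D Z Y).
Proof.
apply: cinf_eqP => z; have [[Z' [alpha [az dz WE]]] Wpr] := hliftP Z z.
(* Z' need only agree with Z at the base point of z *)
rewrite WE pullback_section_momentum (horizontal_momentum Y az dz).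
rewrite -[in LHS]az -[in RHS]az -!pullback_sectionE !pullback_section_momentum.
apply: connection_tensorial => f.
by rewrite -Wpr WE pullback_section_proj.
Qed.

Lemma hlift_lin f Z Z' :
  hlift D (f *: Z + Z') = pullback pr f *: hlift D Z + hlift D Z'.
Proof.
apply: bundle_vfield_eq => [g|Y].
  transitivity (pullback pr f * hlift D Z (pullback pr g) + hlift D Z' (pullback pr g));
    last by [].
  rewrite !hlift_pullback; apply: cinf_eqP => z.
  transitivity (pullback pr f z * pullback pr (Z g) z + pullback pr (Z' g) z);
    last by [].
  by rewrite !pullback_projE.
transitivity (pullback pr f * hlift D Z (momentum Y) + hlift D Z' (momentum Y));
  last by [].
by rewrite !hlift_momentum nabla_linl momentum_lin.
Qed.

(** On momenta the commutator of the two lifts is the commutator of covariant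
    derivatives, which flatness identifies with the derivative along the bracket. *)
Lemma hlift_lie Z Z' : (forall Y, curvature D Z Z' Y = 0) ->
  lie (hlift D Z) (hlift D Z') = hlift D (lie Z Z').
Proof.
move=> flat; apply: bundle_vfield_eq => [f|Y].
  rewrite lieE !hlift_pullback; apply: cinf_eqP => z.
  transitivity (pullback pr (Z (Z' f)) z - pullback pr (Z' (Z f)) z); first by [].
  by rewrite !pullback_projE.
rewrite lieE !hlift_momentum.
have -> : D (lie Z Z') Y = - 1 *: D Z' (D Z Y) + D Z (D Z' Y).
  have := flat Y; rewrite /curvature => /eqP; rewrite subr_eq0 => /eqP <-.
  by rewrite scaleN1r addrC.
rewrite momentum_lin; apply: cinf_eqP => z.
transitivity (momentum (D Z (D Z' Y)) z - momentum (D Z' (D Z Y)) z); first by [].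
transitivity (pullback pr (-1) z * momentum (D Z' (D Z Y)) z + momentum (D Z (D Z' Y)) z);
  last by [].
rewrite pullback_projE; transitivity (-1 * momentum (D Z' (D Z Y)) z + momentum (D Z (D Z' Y)) z);
  last by [].
by rewrite mulN1r addrC.
Qed.

End HorizontalLift.

End CotangentFunctions.

Theorem corollary4p25 (R : realType) (M : atlas R) (hM : is_manifold M)
    (pi : bivector M) (hpi : is_poisson pi) (D : connection M)
    (hD : forall (alpha beta : one_form M) (Z : vfield M),
        curvature D (pi alpha) (pi beta) Z = 0) :
  @courant_action R M (cotangent_bundle M) (poisson_courant pi)
    (@cotangent_proj R M) (fun a => hlift D (pi a.2)).
Proof.
have pr_cst c : pullback (@cotangent_proj R M) (cinf_cst M c) = cinf_cst (cotangent_bundle M) c.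
  by apply: cinf_eqP => z; rewrite pullback_projE.
split.
- exact: poisson_courant_is_courant.
- exact: cotangent_bundle_is_manifold.
- exact: cotangent_proj_smooth.
- by move=> c a b; rewrite sect_lin2 sharp_lin (hlift_lin hM) pr_cst.
- by move=> a q f; rewrite (hlift_pullback hM) pullback_projE.
- move=> f a; have e : pi (f *: a).2 = f *: pi a.2 by rewrite -sharpZ.
  have h0 : hlift D 0 = 0.
    have := hlift_lin hM D (-1) 0 0; rewrite scaler0 addr0.
    have -> : pullback (@cotangent_proj R M) (-1) = -1.
      by apply: cinf_eqP => z; rewrite pullback_projE.
    by rewrite scaleN1r addNr.
  by rewrite e -[f *: _]addr0 (hlift_lin hM) h0 addr0.
- move=> a b; rewrite dorfman2 (sharp_koszul hM hpi); apply: (hlift_lie hM).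
  exact: hD.
Qed.
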